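(* Let $(M,g)$ be a pseudo-Riemannian manifold. There is a one-to-one correspondence between para-3-Sasakian structures $(M,g,T_1,T_2,T_3)$ on $(M,g)$ and para-hyper-Kähler structures $(\widehat M,\widehat g,\widehat J_1,\widehat J_2,\widehat J_3=\widehat J_1\widehat J_2)$ on the cone $(\widehat M,\widehat g)$. The correspondence is given by $T_\alpha\mapsto\widehat J_\alpha:=\widehat\nabla T_\alpha$, $\alpha=1,2,3$.
   Context: Manifolds are connected. The cone over $(M,g)$ is $\widehat M=\mathbb R^+\times M$ with metric $\widehat g=dr^2+r^2g$, $r$ the coordinate on $\mathbb R^+=(0,\infty)$, and $\widehat\nabla$ is its Levi-Civita connection; $\nabla$ is the Levi-Civita connection of $g$. A vector field $T$ on $M$ is also regarded as an ($r$-independent) vector field on $\widehat M$ tangent to $M$, and $\widehat\nabla T$ denotes the endomorphism field $U\mapsto\widehat\nabla_UT$. Signature $(p,q)$ means $p$ negative (time-like) and $q$ positive (space-like) directions. A para-complex structure on a finite-dimensional real vector space $V$ is $J\in\mathrm{End}(V)$ with $J^2=\mathrm{Id}$ whose two eigenspaces for $\pm1$ have the same dimension. A para-hyper-complex structure on $V$ is a triple $(J_1,J_2,J_3=J_1J_2)$ where $J_1,J_2$ are anticommuting para-complex structures. An almost para-complex structure on a distribution $\mathcal V$ is a field $J\in \Gamma(\mathrm{End}\,\mathcal V)$ of para-complex structures; it is integrable if its eigen-distributions $\ker(\mathrm{Id}\mp J)$ are involutive. An almost para-hyper-complex structure on a distribution $\mathcal V$ is a triple $J_\alpha\in\Gamma(\mathrm{End}\,\mathcal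 V)$ which is a para-hyper-complex structure on $\mathcal V_p$ for each $p$. A para-hyper-Kähler structure on a pseudo-Riemannian manifold $(N,h)$ is a parallel (for the Levi-Civita connection of $h$) para-hyper-complex structure $(J_1,J_2,J_3=J_1J_2)$ on $TN$ consisting of $h$-skew-symmetric endomorphism fields. A para-Sasakian structure $(g,T)$ on $M$: $g$ has signature $(n+1,n)$ ($n+1$ time-like dimensions), $T$ is a time-like geodesic unit Killing vector field and $\nabla T$ defines an integrable para-complex structure $\nabla T|_{T^\perp}$ on $T^\perp$. A (pseudo-)Sasakian structure $(g,T)$: $T$ is a space-like unit Killing vector field such that $\phi:=\nabla T$ satisfies $\phi^2=-\mathrm{id}+g(\cdot,T)T$ and $(\nabla_U\phi)V=-g(U,V)T+g(V,T)U$ for all $U,V$. A para-3-Sasakian structure $(M,g,T_1,T_2,T_3)$ is a pseudo-Riemannian manifold $(M,g)$ of signature $(n+1,n)$ endowed with three orthogonal unit Killing vector fields $T_1,T_2,T_3$ such that (i) $T_1,T_2$ are time-like and define para-Sasakian structures $(g,T_1)$, $(g,T_2)$; (ii) $T_3$ is space-like and defines a (pseudo-)Sasakian structure $(g,T_3)$; (iii) $\nabla_{T_2}T_1=T_3$; (iv) $[T_1,T_2]=-2T_3$, $[T_1,T_3]=-2T_2$, $[T_2,T_3]=2T_1$; (v) the tensors $\nabla T_\alpha$ ($\alpha=1,2,3$) define a para-hyper-complex structure on $E:=\mathrm{span}\{T_1,T_2,T_3\}^\perp$ (by (ii)–(iii) one has $\nabla_ET_\alpha\subset E$). *)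

(* Defs.v *)
From HB Require Import structures.
From mathcomp Require Import all_boot all_order all_algebra.
From mathcomp Require Import all_classical all_reals all_analysis.
Set Implicit Arguments.
Unset Strict Implicit.
Unset Printing Implicit Defensive.
Import Order.TTheory GRing.Theory Num.Theory.
Import numFieldNormedType.Exports.
Local Open Scope classical_set_scope.
Local Open Scope ring_scope.

(** * Smooth maps on subsets of R^m *)

Section Smooth.
Variables (R : realType) (m : nat) (V : normedModType R).

(* [Ck k U f]: all iterated partial derivatives of [f] of order at most [k]
   exist and are continuous at every point of the (open) set [U]. *)
Fixpoint Ck (k : nat) (U : set 'rV[R]_m) (f : 'rV[R]_m -> V) : Prop :=
  (forall x, U x -> {for x, continuous f}) /\
  if k is k'.+1 then
    forall i : 'I_m,
      (forall x, U x -> derivable f x (delta_mx 0 i)) /\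
      Ck k' U (fun x => 'D_(delta_mx 0 i) f x)
  else True.

Definition smooth (U : set 'rV[R]_m) (f : 'rV[R]_m -> V) : Prop :=
  forall k, Ck k U f.

End Smooth.

(** * Manifolds *)

(* A chart is a pair of mutually inverse maps between a subset of [M] and a
   subset of R^m; outside these sets [coord] and [inv_coord] take junk values. *)
Record chart (R : realType) (m : nat) (M : Type) := Chart {
  dom : set M;
  coord : M -> 'rV[R]_m;
  inv_coord : 'rV[R]_m -> M
}.

Definition img (R : realType) (m : nat) (M : Type) (c : chart R m M) :
  set 'rV[R]_m := coord c @` dom c.

(* A space in which every point [p] carries a preferred chart [chart_at p]
   around it; the atlas consists of these charts.  The tangent space at [p] is
   identified, once and for all, with [R^m] by the coordinates of
   [chart_at p]. *)
Record charted (R : realType) (m : nat) := Charted {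
  carrier :> topologicalType;
  chart_at : carrier -> chart R m carrier
}.

Definition is_chart (R : realType) (m : nat) (M : topologicalType)
    (c : chart R m M) : Prop :=
  [/\ open (dom c), open (img c),
      (forall p, dom c p -> inv_coord c (coord c p) = p),
      (forall p, dom c p -> {for p, continuous (coord c)}) &
      (forall x, img c x -> {for x, continuous (inv_coord c)})].

Definition is_manifold (R : realType) (m : nat) (M : charted R m) : Prop :=
  [/\ hausdorff_space M, @second_countable M, connected [set: M],
      (forall p : M, is_chart (chart_at p) /\ dom (chart_at p) p) &
      (forall p q : M,
         smooth (coord (chart_at p) @` (dom (chart_at p) `&` dom (chart_at q)))
           (coord (chart_at q) \o inv_coord (chart_at p)))].

Section Manifold.
Variables (R : realType) (m : nat) (M : charted R m).

Notation tangent := 'rV[R]_m.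

(* Functions, vector fields, endomorphism fields and bilinear forms are total
   functions on [M]; their smoothness near a point is a separate condition, so
   that they also serve as local sections. *)
Definition vfield := M -> tangent.
Definition endfield := M -> 'End(tangent).
Definition distribution := M -> {vspace tangent}.

(* The derivative [v(f)] of [f] along the tangent vector [v] at [p]. *)
Definition dir (V : normedModType R) (f : M -> V) (p : M) (v : tangent) : V :=
  'D_v (f \o inv_coord (chart_at p)) (coord (chart_at p) p).

(* [F] is an expression in the coordinates of [chart_at p]. *)
Definition smooth_near (V : normedModType R) (p : M) (F : 'rV[R]_m -> V) :=
  exists2 U : set 'rV[R]_m,
    [/\ open U, U `<=` img (chart_at p) & U (coord (chart_at p) p)] &
    smooth U F.

Definition smooth_fun (f : M -> R^o) (p : M) : Prop :=
  smooth_near p (f \o inv_coord (chart_at p)).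

(* The component functions, in the chart [c], of the vector field [X]: at the
   point [q], the derivative of the coordinates of [c] along [X q]. *)
Definition components (c : chart R m M) (X : vfield) (x : 'rV[R]_m) : 'rV[R]_m :=
  dir (coord c) (inv_coord c x) (X (inv_coord c x)).

Definition smooth_field (X : vfield) (p : M) : Prop :=
  smooth_near p (components (chart_at p) X).

(* [X, Y]^i = X(Y^i) - Y(X^i) in the coordinates of [chart_at p]. *)
Definition bracket (X Y : vfield) : vfield := fun p =>
  let c := chart_at p in
  'D_(X p) (components c Y) (coord c p) - 'D_(Y p) (components c X) (coord c p).

Definition is_section (D : distribution) (X : vfield) (p : M) : Prop :=
  smooth_field X p /\ \forall q \near p, X q \in D q.

Definition involutive_distr (D : distribution) : Prop :=
  forall (p : M) (X Y : vfield), is_section D X p -> is_section D Y p ->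
    bracket X Y p \in D p.

(** ** Metrics, given by their Gram matrices *)

Definition ip (h : 'M[R]_m) (u v : tangent) : R := (u *m h *m v^T) 0 0.

(* [orth h s] is the [h]-orthogonal complement of the span of [s]. *)
Definition orth (h : 'M[R]_m) (s : seq tangent) : {vspace tangent} :=
  (\bigcap_(u <- s) lker (linfun (mulmxr (h *m u^T))))%VS.

(* [a] negative and [b] positive directions: the rows of [P] form a
   pseudo-orthonormal basis. *)
Definition signature (h : 'M[R]_m) (a b : nat) : Prop :=
  m = (a + b)%N /\
  exists2 P : 'M[R]_m, P \in unitmx &
    P *m h *m P^T = diag_mx (\row_(i < m) (if (i < a)%N then -1 else 1)).

Definition pseudo_riemannian (g : M -> 'M[R]_m) : Prop :=
  [/\ (forall p, (g p)^T = g p), (forall p, g p \in unitmx) &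
      forall p (X Y : vfield), smooth_field X p -> smooth_field Y p ->
        smooth_fun (fun q => ip (g q) (X q) (Y q)) p].

(* The Lie derivative of [g] along [T] vanishes. *)
Definition killing (g : M -> 'M[R]_m) (T : vfield) : Prop :=
  forall p (X Y : vfield), smooth_field X p -> smooth_field Y p ->
    dir (fun q => ip (g q) (X q) (Y q) : R^o) p (T p) =
    ip (g p) (bracket T X p) (Y p) + ip (g p) (X p) (bracket T Y p).

(** ** Affine connections: [D X p v] is the covariant derivative of [X] at [p]
    along [v], so that [D X] is the endomorphism field [U |-> D_U X] *)

Definition is_connection (D : vfield -> endfield) : Prop :=
  [/\ (forall p (X Y : vfield), smooth_field X p -> smooth_field Y p ->
         smooth_field (fun q => D X q (Y q)) p),
      (forall p (X Y : vfield), smooth_field X p -> smooth_field Y p ->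
         D (fun q => X q + Y q) p = D X p + D Y p) &
      (forall p (f : M -> R^o) (X : vfield),
         smooth_fun f p -> smooth_field X p -> forall v,
         D (fun q => f q *: X q) p v = dir f p v *: X p + f p *: D X p v)].

Definition levi_civita (g : M -> 'M[R]_m) (D : vfield -> endfield) : Prop :=
  [/\ is_connection D,
      (forall p (X Y : vfield), smooth_field X p -> smooth_field Y p ->
         D Y p (X p) - D X p (Y p) = bracket X Y p) &
      (forall p (X Y : vfield), smooth_field X p -> smooth_field Y p ->
         forall v, dir (fun q => ip (g q) (X q) (Y q) : R^o) p v =
           ip (g p) (D X p v) (Y p) + ip (g p) (X p) (D Y p v))].

(* (D_u phi) V = D_u (phi V) - phi (D_u V) *)
Definition cov_end (D : vfield -> endfield) (phi : endfield) (V : vfield)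
    (p : M) (u : tangent) : tangent :=
  D (fun q => phi q (V q)) p u - phi p (D V p u).

Definition parallel (D : vfield -> endfield) (phi : endfield) : Prop :=
  forall p (V : vfield), smooth_field V p -> forall u, cov_end D phi V p u = 0.

(** ** Para-complex and para-hyper-complex structures.  An endomorphism of a
    subspace [W] is given by an endomorphism of the tangent space which
    preserves [W] *)

Definition eigen_plus (J : 'End(tangent)) : {vspace tangent} := lker (\1%VF - J).
Definition eigen_minus (J : 'End(tangent)) : {vspace tangent} := lker (\1%VF + J).

Definition para_complex (W : {vspace tangent}) (J : 'End(tangent)) : Prop :=
  [/\ (J @: W <= W)%VS, (forall v, v \in W -> J (J v) = v) &
      \dim (W :&: eigen_plus J) = \dim (W :&: eigen_minus J)].

Definition para_hyper_complex (W : {vspace tangent}) (J1 J2 J3 : 'End(tangent)) :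
    Prop :=
  [/\ para_complex W J1, para_complex W J2,
      (forall v, v \in W -> J1 (J2 v) = - J2 (J1 v)) &
      (forall v, v \in W -> J3 v = J1 (J2 v))].

Definition smooth_end (D : distribution) (J : endfield) : Prop :=
  forall p (X : vfield), is_section D X p -> is_section D (fun q => J q (X q)) p.

Definition almost_para_complex (D : distribution) (J : endfield) : Prop :=
  smooth_end D J /\ forall p, para_complex (D p) (J p).

Definition integrable (D : distribution) (J : endfield) : Prop :=
  involutive_distr (fun p => D p :&: eigen_plus (J p))%VS /\
  involutive_distr (fun p => D p :&: eigen_minus (J p))%VS.

Definition almost_para_hyper_complex (D : distribution) (J1 J2 J3 : endfield) :
    Prop :=
  [/\ smooth_end D J1, smooth_end D J2, smooth_end D J3 &
      forall p, para_hyper_complex (D p) (J1 p) (J2 p) (J3 p)].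

(** ** Para-hyper-Kaehler, para-Sasakian, Sasakian and para-3-Sasakian
    structures; [D] stands for the Levi-Civita connection of the metric *)

Definition skew (h : M -> 'M[R]_m) (J : endfield) : Prop :=
  forall p u v, ip (h p) (J p u) v = - ip (h p) u (J p v).

Definition para_hyper_kahler (h : M -> 'M[R]_m) (D : vfield -> endfield)
    (J : endfield * endfield * endfield) : Prop :=
  let: (J1, J2, J3) := J in
  [/\ almost_para_hyper_complex (fun=> fullv) J1 J2 J3,
      [/\ skew h J1, skew h J2 & skew h J3] &
      [/\ parallel D J1, parallel D J2 & parallel D J3]].

Definition smooth_vfield (T : vfield) : Prop := forall p, smooth_field T p.

Definition para_sasakian (g : M -> 'M[R]_m) (D : vfield -> endfield)
    (T : vfield) : Prop :=
  let Tperp := fun p => orth (g p) [:: T p] in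
  [/\ exists n, forall p, signature (g p) n.+1 n,
      smooth_vfield T /\ killing g T,
      (forall p, ip (g p) (T p) (T p) = -1),
      (forall p, D T p (T p) = 0) &
      almost_para_complex Tperp (D T) /\ integrable Tperp (D T)].

Definition sasakian (g : M -> 'M[R]_m) (D : vfield -> endfield)
    (T : vfield) : Prop :=
  [/\ smooth_vfield T /\ killing g T,
      (forall p, ip (g p) (T p) (T p) = 1),
      (forall p v, D T p (D T p v) = - v + ip (g p) v (T p) *: T p) &
      (forall p (V : vfield), smooth_field V p -> forall u,
         cov_end D (D T) V p u =
         - ip (g p) u (V p) *: T p + ip (g p) (V p) (T p) *: u)].

Definition para_3_sasakian (g : M -> 'M[R]_m) (D : vfield -> endfield)
    (T : vfield * vfield * vfield) : Prop :=
  let: (T1, T2, T3) := T in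
  let E := fun p => orth (g p) [:: T1 p; T2 p; T3 p] in
  [/\ exists n, forall p, signature (g p) n.+1 n,
      (forall p, [/\ ip (g p) (T1 p) (T2 p) = 0, ip (g p) (T1 p) (T3 p) = 0 &
                     ip (g p) (T2 p) (T3 p) = 0]),
      [/\ para_sasakian g D T1, para_sasakian g D T2 & sasakian g D T3],
      (forall p, D T1 p (T2 p) = T3 p) &
      (forall p, [/\ bracket T1 T2 p = - 2 *: T3 p,
                     bracket T1 T3 p = - 2 *: T2 p &
                     bracket T2 T3 p = 2 *: T1 p]) /\
      almost_para_hyper_complex E (D T1) (D T2) (D T3)].

End Manifold.

(** * The cone *)

Section Cone.
Variables (R : realType) (m : nat) (M : charted R m).

Definition half_line : topologicalType := set_type [set r : R | 0 < r].

Definition half_line1 : half_line :=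
  SigSub (mem_set (ltr01 : [set r : R | 0 < r] 1)).

Definition cone_chart (c : chart R m M) : chart R (1 + m) (half_line * M)%type :=
  {| dom := [set: half_line] `*` dom c;
     coord := fun z => row_mx (const_mx (val z.1)) (coord c z.2);
     inv_coord := fun x =>
       (insubd half_line1 (lsubmx x 0 0), inv_coord c (rsubmx x)) |}.

(* In these charts the tangent space at [(r, p)] is the sum of the line spanned
   by d/dr and of the tangent space of [M] at [p]. *)
Definition cone : charted R (1 + m) :=
  {| carrier := (half_line * M)%type;
     chart_at := fun z => cone_chart (chart_at z.2) |}.

(* dr^2 + r^2 g *)
Definition cone_metric (g : M -> 'M[R]_m) (z : cone) : 'M[R]_(1 + m) :=
  block_mx 1%:M 0 0 (val z.1 ^+ 2 *: g z.2).

Definition cone_lift (T : vfield M) : vfield cone := fun z => row_mx 0 (T z.2).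

End Cone.

(* Main.v *)
From HB Require Import structures.
Require Import Defs.
From mathcomp Require Import all_boot all_order all_algebra.
From mathcomp Require Import all_classical all_reals all_analysis.
From mathcomp Require Import ring lra.
Import Order.TTheory GRing.Theory Num.Theory.
Import numFieldNormedType.Exports.
Import Defs.
Local Open Scope classical_set_scope.
Local Open Scope ring_scope.

(* Write r for the radial coordinate of the cone.  Its Levi-Civita connection
   satisfies nabla^ (r d/dr) = Id, nabla^_(d/dr) X = X / r and
   nabla^_v X = nabla_v X - r g(X, v) d/dr for fields X on M, so that
   J = nabla^ T maps r d/dr to T and v to nabla_v T - r g(T, v) d/dr.  When T is
   Killing, the only component of nabla^ J which can be nonzero is
   (nabla^_v J) x = (nabla_v phi) x - g(x, T) v + g(x, v) T with phi = nabla T,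
   and the para-quaternionic relations of the J_alpha amount to pointwise
   relations between the T_alpha and the nabla T_alpha.

   From M to the cone: nabla^ J3 = 0 is the Sasakian identity of T3.  Let
   S_a = nabla^ J_a.  From J1 = J3 J2 and J2 = J1 J3 one gets S1 = J3 S2 and
   S2 = S1 J3, so S1 anticommutes with J3, which exchanges the eigenspaces of J1.
   Integrability of nabla T1 makes g^(S1_A B, C) symmetric in A, B and skew in
   B, C on each eigenspace of J1 in the orthogonal of d/dr and J1 d/dr, hence
   S1_A = 0 there, and likewise for S2 with J2 d/dr.  Since J1 d/dr is
   orthogonal to J2 d/dr and S1 = J3 S2, this covers all directions.

   From the cone to M: if J is parallel, Z = J (r d/dr) satisfies nabla^ Z = J.
   As Z is tangent to M, the vanishing of the torsion gives [d/dr, Z] = 0, so Z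
   is the lift of a field T on M, and J = nabla^ T. *)

Set Implicit Arguments.
Unset Strict Implicit.
Unset Printing Implicit Defensive.

(** * Iterated partial derivatives *)

(** A para-Sasakian structure prescribes no formula for the covariant derivative of [nabla T], only
    involutive eigendistributions; this is why S1 and S2 must be recovered from S3. The mechanism is
    that an expression in three arguments, symmetric in the first two and skew in the last two,
    vanishes ([braid_eq0]). The same fact determines the connection of the cone.

    From the cone to M, the signature (n+1, n) of [g] is not among the data and has to be derived.
    It is forced: nabla T1 preserves the orthogonal of T1 and reverses the sign of [g] there, so
    that this space has as many time-like as space-like directions.

    The derivative ['D_v f] is a limit along a line, which is linear in [v] only when [f] is
    differentiable, whereas smoothness is expressed by partial derivatives. The calculus in charts
    therefore rests on the differentiability of C^1 maps. *)

Section CkTheory.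
Variables (R : realType) (m : nat).
Implicit Types (U : set 'rV[R]_m) (x v : 'rV[R]_m).

Lemma near_open (T : topologicalType) (U : set T) (x : T) (P : T -> Prop) :
  open U -> U x -> (forall y, U y -> P y) -> nbhs x P.
Proof. by move=> oU Ux UP; apply: filterS UP _; apply: open_nbhs_nbhs. Qed.

Lemma nbhsS (T : topologicalType) (x : T) (P Q : set T) :
  P `<=` Q -> nbhs x P -> nbhs x Q.
Proof. exact: filterS. Qed.

Lemma nbhs_and (T : topologicalType) (x : T) (P Q : set T) :
  nbhs x P -> nbhs x Q -> nbhs x (P `&` Q).
Proof. exact: filterI. Qed.

Lemma near_continuous (T T' : topologicalType) (x : T) (f f' : T -> T') :
  nbhs x (fun y => f y = f' y) -> {for x, continuous f} -> {for x, continuous f'}.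
Proof.
move=> ff'; rewrite /prop_for /continuous_at -(nbhs_singleton ff') => cf.
by apply: cvg_trans cf; apply: near_eq_cvg.
Qed.

Lemma Ck_eq (V : normedModType R) k U (f f' : 'rV[R]_m -> V) : open U ->
  (forall x, U x -> f x = f' x) -> Ck k U f -> Ck k U f'.
Proof.
move=> oU; elim: k f f' => [|k IH] f f' ff' /= [cf df]; split=> //.
- by move=> x Ux; apply: near_continuous (cf x Ux); apply: near_open oU Ux ff'.
- by move=> x Ux; apply: near_continuous (cf x Ux); apply: near_open oU Ux ff'.
- move=> i; have [di Di] := df i; split.
    by move=> x Ux; apply: near_eq_derivable (di x Ux); apply: near_open oU Ux ff'.
  apply: IH Di => x Ux; apply: near_eq_derive.
  exact: near_open oU Ux ff'.
Qed.

Lemma Ck_sub (V : normedModType R) k U U' (f : 'rV[R]_m -> V) :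
  U' `<=` U -> Ck k U f -> Ck k U' f.
Proof.
move=> sU; elim: k f => [|k IH] f [cf df]; split=> //.
- by move=> x /sU; apply: cf.
- by move=> x /sU; apply: cf.
- move=> i; have [di Di] := df i; split; first by move=> x /sU; apply: di.
  exact: IH.
Qed.

Lemma CkW (V : normedModType R) k U (f : 'rV[R]_m -> V) :
  Ck k.+1 U f -> Ck k U f.
Proof.
elim: k f => [|k IH] f; first by case.
case=> cf df; split=> // i; have [di Di] := df i; split=> //.
exact: IH.
Qed.

Lemma Ck_cst (V : normedModType R) k U (a : V) : Ck k U (fun=> a).
Proof.
elim: k a => [|k IH] a; split=> //.
- by move=> x _; exact: (@cst_continuous _ _ a).
- by move=> x _; exact: (@cst_continuous _ _ a).
- move=> i; split; first by move=> x _; exact: (@derivable_cst R _ _ a).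
  have -> : (fun x => 'D_(delta_mx 0 i) (fun=> a) x) = (fun=> 0).
    by apply/funext => x; rewrite derive_cst.
  exact: IH.
Qed.

Lemma Ck_add (V : normedModType R) k U (f f' : 'rV[R]_m -> V) : open U ->
  Ck k U f -> Ck k U f' -> Ck k U (fun x => f x + f' x).
Proof.
move=> oU; elim: k f f' => [|k IH] f f' [cf df] [cf' df']; split=> //.
- by move=> x Ux; exact: (continuousD (cf x Ux) (cf' x Ux)).
- by move=> x Ux; exact: (continuousD (cf x Ux) (cf' x Ux)).
- move=> i; have [di Di] := df i; have [di' Di'] := df' i; split.
    by move=> x Ux; apply: derivableD; [apply: di|apply: di'].
  apply: Ck_eq oU _ (IH _ _ Di Di') => x Ux.
  by rewrite [RHS]deriveD //; [apply: di|apply: di'].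
Qed.

Lemma derive_scale n (f : 'rV[R]_m -> R^o) (X : 'rV[R]_m -> 'rV[R]_n) x v :
  derivable f x v -> derivable X x v ->
  derivable (fun y => f y *: X y) x v /\
  'D_v (fun y => f y *: X y) x = 'D_v f x *: X x + f x *: 'D_v X x.
Proof.
move=> df dX; have dXij := (derivable_mxP _ _ _).1 dX.
have E i j : (fun y => (f y *: X y) i j) = (f : _ -> R) * (fun y => X y i j).
  by apply/funext => y; rewrite mxE.
have dM i j := @derivableM _ _ f (fun y => X y i j) x v df (dXij i j).
have d : derivable (fun y => f y *: X y) x v.
  by apply/derivable_mxP => i j; rewrite E; exact: dM.
split=> //; rewrite (derive_mx d) (derive_mx dX); apply/matrixP => i j; rewrite !mxE E.
rewrite (@deriveM _ _ f (fun y => X y i j) x v df (dXij i j)) addrC.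
by congr (_ + _); exact: mulrC.
Qed.

Lemma Ck_scale n k U (f : 'rV[R]_m -> R^o) (X : 'rV[R]_m -> 'rV[R]_n) :
  open U -> Ck k U f -> Ck k U X -> Ck k U (fun x => f x *: X x).
Proof.
move=> oU; elim: k f X => [|k IH] f X Cf CX.
  split; last exact: I.
  by move=> x Ux; exact: (continuousZ (Cf.1 x Ux) (CX.1 x Ux)).
split=> [x Ux|i]; first exact: (continuousZ (Cf.1 x Ux) (CX.1 x Ux)).
have [di Di] := Cf.2 i; have [di' Di'] := CX.2 i; split=> [x Ux|].
  exact: (derive_scale (di x Ux) (di' x Ux)).1.
have := Ck_add oU (IH _ _ Di (CkW CX)) (IH _ _ (CkW Cf) Di').
apply: Ck_eq oU _ => x Ux.
exact/esym/(derive_scale (di x Ux) (di' x Ux)).2.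
Qed.

Lemma derive_lin (V W X : normedModType R) (L : {linear V -> W}) (f : X -> V)
    (x v : X) :
  continuous L -> derivable f x v ->
  derivable (L \o f) x v /\ 'D_v (L \o f) x = L ('D_v f x).
Proof.
move=> cL df; suff H : is_derive x v (L \o f) (L ('D_v f x)).
  by split; [exact: ex_derive|exact: derive_val].
have lim : (fun h : R => h^-1 *: ((L \o f) (h *: v + x) - (L \o f) x)) @ 0^' --> L ('D_v f x).
  have -> : (fun h : R => h^-1 *: ((L \o f) (h *: v + x) - (L \o f) x)) =
      L \o (fun h : R => h^-1 *: (f (h *: v + x) - f x)).
    by apply/funext => h; rewrite /= -linearB linearZZ.
  exact: (cvg_comp _ _ df (cL _)).
apply: DeriveDef; first by apply/cvg_ex; eexists; exact: lim.
exact: cvg_lim lim.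
Qed.

Lemma Ck_lin (V W : normedModType R) (L : {linear V -> W}) k U
    (f : 'rV[R]_m -> V) : open U -> continuous L ->
  Ck k U f -> Ck k U (fun x => L (f x)).
Proof.
move=> oU cL; elim: k f => [|k IH] f [cf df]; split=> //.
- by move=> x Ux; exact: (continuous_comp (cf x Ux) (cL _)).
- by move=> x Ux; exact: (continuous_comp (cf x Ux) (cL _)).
- move=> i; have [di Di] := df i; split.
    by move=> x Ux; exact: (derive_lin cL (di x Ux)).1.
  apply: Ck_eq oU _ (IH _ Di) => x Ux.
  exact/esym/(derive_lin cL (di x Ux)).2.
Qed.

(** Estimate for a single coordinate step in [C1_differentiable_real]; the split on the sign of [t]
    orients the interval for the mean value theorem. *)
Lemma mvt_bound (f : R -> R) (t c e : R) :
  (forall s, `|s| <= `|t| -> derivable f s 1 /\ `|'D_1 f s - c| <= e) ->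
  `|f t - f 0 - t * c| <= e * `|t|.
Proof.
move=> H.
have cf s : `|s| <= `|t| -> {for s, continuous f}.
  by move=> /H[ds _]; apply/differentiable_continuous/derivable1_diffP.
have [t0|t0|t0] := ltgtP 0 t.
- have [||s] := @MVT R f (fun s => 'D_1 f s) 0 t t0.
  + move=> s; rewrite in_itv /= => /andP[s0 st]; apply: derivableP.
    by apply: (H _ _).1; rewrite !gtr0_norm // ltW.
  + apply: continuous_in_subspaceT => s; rewrite inE /= in_itv /= => /andP[s0 st].
    by apply: cf; rewrite (ger0_norm s0) gtr0_norm.
  + rewrite in_itv /= => /andP[s0 st] ->; rewrite subr0 mulrC -mulrBr normrM mulrC.
    apply: ler_wpM2r => //; apply: (H _ _).2.
    by rewrite !gtr0_norm // ltW.
- have [||s] := @MVT R f (fun s => 'D_1 f s) t 0 t0.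
  + move=> s; rewrite in_itv /= => /andP[s0 st]; apply: derivableP.
    by apply: (H _ _).1; rewrite !ltr0_norm // lerN2 ltW.
  + apply: continuous_in_subspaceT => s; rewrite inE /= in_itv /= => /andP[s0 st].
    by apply: cf; rewrite (ler0_norm st) ltr0_norm // lerN2.
  + rewrite in_itv /= => /andP[s0 st] E.
    have -> : f t - f 0 - t * c = ('D_1 f s - c) * t.
      by rewrite -[f t - f 0]opprB E sub0r mulrN opprK mulrBl (mulrC c).
    rewrite normrM; apply: ler_wpM2r => //; apply: (H _ _).2.
    by rewrite !ltr0_norm // lerN2 ltW.
- by rewrite -t0 subrr mul0r subrr normr0 mulr0.
Qed.

Lemma norm_rV_ge (n : nat) (h : 'rV[R]_n) i : `|h 0 i| <= `|h|.
Proof.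
rewrite [leRHS]/Num.norm /= mx_normrE.
exact: (le_bigmax _ (fun ij : 'I_1 * 'I_n => `|h ij.1 ij.2|) (0, i)).
Qed.

Lemma norm_rV_le (n : nat) (h : 'rV[R]_n) (b : R) : 0 <= b ->
  (forall i, `|h 0 i| <= b) -> `|h| <= b.
Proof.
move=> b0 H; rewrite [leLHS]/Num.norm /= mx_normrE.
by apply: bigmax_le => // -[i j] _ /=; rewrite ord1.
Qed.

Lemma differentiable_of_bound (V W : normedModType R) (f : V -> W)
    (L : {linear V -> W}) (x : V) : continuous L ->
  (forall e, 0 < e ->
     \forall h \near 0, `|f (h + x) - f x - L h| <= e * `|h|) ->
  differentiable f x.
Proof.
move=> cL fL.
have E : f \o shift x = cst (f x) + L +o_ 0 id.
  apply/eqaddoP => e /fL; apply: filterS => h /=.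
  by rewrite -addrA -opprD.
have dE := diff_unique cL E.
by apply/diff_locallyP; rewrite dE; split.
Qed.

Lemma derive_line (V W : normedModType R) (f : V -> W) (v y : V) (s : R) :
  (derivable (fun t : R => f (t *: v + y)) s 1 <-> derivable f (s *: v + y) v) /\
  'D_1 (fun t : R => f (t *: v + y)) s = 'D_v f (s *: v + y).
Proof.
rewrite /derivable /derive.
suff -> : (fun h : R => h^-1 *: (((fun t => f (t *: v + y)) \o shift s) (h *: 1) -
    f (s *: v + y))) =
    (fun h => h^-1 *: ((f \o shift (s *: v + y)) (h *: v) - f (s *: v + y))) by [].
by apply/funext => h /=; rewrite [h *: 1]mulr1 scalerDl addrA.
Qed.

(** Going from [x] to [h + x] along the coordinate axes, each of the [m] steps is controlled by one
    partial derivative, which is close to its value at [x] by continuity. *)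
Lemma C1_differentiable_real U (f : 'rV[R]_m -> R^o) x : open U -> U x ->
  Ck 1 U f -> differentiable f x.
Proof.
move=> oU Ux [cf df].
pose d i y : R := 'D_(delta_mx 0 i) f y.
pose dflin (h : 'rV[R]_m) : R^o := \sum_i h 0 i * d i x.
have dflinear : linear dflin.
  move=> a u w; rewrite /dflin scaler_sumr -big_split /=; apply: eq_bigr => i _.
  by rewrite !mxE mulrDl -mulrA.
pose LM := GRing.isLinear.Build _ _ _ _ dflin dflinear.
pose L : {linear 'rV[R]_m -> R^o} := HB.pack dflin LM.
have cL : continuous L.
  move=> y; apply: (@differentiable_continuous _ _ _ y dflin).
  have -> : dflin = \sum_i (fun h : 'rV[R]_m => d i x *: (h 0 i : R^o)).
    apply/funext => h; rewrite fct_sumE; apply: eq_bigr => i _.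
    exact: mulrC.
  by apply: differentiable_sum => i; apply: differentiableZ; exact: differentiable_coord.
apply: (differentiable_of_bound cL) => e e0.
(* The divisor is [m.+1] rather than [m] so that it is nonzero for [m = 0]. *)
have e'0 : 0 < e / m.+1%:R by rewrite divr_gt0.
have : \forall y \near x, U y /\ forall i, `|d i x - d i y| <= e / m.+1%:R.
  near=> y; split; first by near: y; exact: open_nbhs_nbhs.
  near: y; apply: filter_forall => i.
  have [_ [cd _]] := df i.
  by have /cvgrPdist_le := cd x Ux; apply.
move=> /nbhs_ballP[r /= r0 Hr].
near=> h.
have hr : `|h| < r.
  by near: h; apply/nbhs_ballP; exists r => // y; rewrite -ball_normE /= sub0r normrN.
(* The corners of the staircase path from 0 to [h]: the first [k] coordinates of [h], then zeros. *)
pose pre k : 'rV[R]_m := \row_i (if (i < k)%N then h 0 i else 0).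
have preS (i : 'I_m) : pre i.+1 = h 0 i *: delta_mx 0 i + pre i.
  apply/rowP => j; rewrite !mxE eqxx /=; case: (ltngtP j i) => [ji|ij|/val_inj ->].
  - by rewrite ltnS (ltnW ji) -val_eqE ltn_eqF // mulr0 add0r.
  - by rewrite ltnS leqNgt ij /= -val_eqE gtn_eqF // mulr0 add0r.
  - by rewrite ltnS leqnn eqxx mulr1 addr0.
have pre0 : pre 0%N = 0 by apply/rowP => j; rewrite !mxE.
have prem : pre m = h by apply/rowP => j; rewrite !mxE ltn_ord.
(* In the sup norm no point of the staircase is further from its start than [h]. *)
have near_pre (i : 'I_m) s : `|s| <= `|h 0 i| ->
    ball x r (s *: delta_mx 0 i + (pre i + x)).
  move=> sh; rewrite -ball_normE /= addrA opprD addrCA subrr addr0 normrN.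
  apply: le_lt_trans hr; apply: norm_rV_le => // j; rewrite !mxE eqxx /=.
  apply: le_trans (norm_rV_ge h j); case: (ltngtP j i) => [ji|ij|/val_inj ->].
  - by rewrite -val_eqE ltn_eqF // mulr0 add0r.
  - by rewrite -val_eqE gtn_eqF // mulr0 add0r normr0.
  - by rewrite eqxx mulr1 addr0.
have step (i : 'I_m) :
    `|f (pre i.+1 + x) - f (pre i + x) - h 0 i * d i x| <= e / m.+1%:R * `|h|.
  pose phi (s : R) : R := f (s *: delta_mx 0 i + (pre i + x)).
  have := @mvt_bound phi (h 0 i) (d i x) (e / m.+1%:R).
  rewrite /phi scale0r add0r preS addrA => H.
  apply: le_trans (H _) _; last first.
    by apply: ler_wpM2l; [exact: ltW|exact: norm_rV_ge].
  move=> s /near_pre/Hr [Us /(_ i)]; rewrite distrC => ds.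
  have [/(_ _ Us) dd _] := df i.
  have [dP dE] := derive_line f (delta_mx 0 i) (pre i + x) s.
  by rewrite /phi dE; split; [exact/dP|exact: ds].
have -> : f (h + x) - f x - L h =
    \sum_(i < m) (f (pre i.+1 + x) - f (pre i + x) - h 0 i * d i x).
  rewrite sumrB -(big_mkord xpredT (fun k => f (pre k.+1 + x) - f (pre k + x))).
  by rewrite telescope_sumr // prem pre0 add0r.
apply: le_trans (ler_norm_sum _ _ _) _.
apply: (@le_trans _ _ (\sum_(i < m) (e / m.+1%:R * `|h|))).
  by apply: ler_sum => i _; exact: step.
rewrite sumr_const card_ord -[leLHS]mulr_natl mulrA ler_wpM2r //.
rewrite mulrCA -[leRHS]mulr1 ler_pM2l // ler_pdivrMr // mul1r.
by rewrite ler_nat.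
Unshelve. all: by end_near.
Qed.

Lemma C1_differentiable n U (f : 'rV[R]_m -> 'rV[R]_n) x : open U -> U x ->
  Ck 1 U f -> differentiable f x.
Proof.
move=> oU Ux Cf.
have dj (j : 'I_n) : differentiable (fun y => f y 0 j : R^o) x.
  pose l (N : 'rV[R]_n) : R^o := N 0 j.
  have ll : linear l by move=> a u v; rewrite /l !mxE.
  pose LM := GRing.isLinear.Build _ _ _ _ l ll.
  pose L : {linear 'rV[R]_n -> R^o} := HB.pack l LM.
  have cL : continuous L by exact: coord_continuous.
  exact: (C1_differentiable_real oU Ux (Ck_lin oU cL Cf)).
have -> : f = \sum_j (fun y : 'rV[R]_m => f y 0 j *: (delta_mx 0 j : 'rV[R]_n)).
  by apply/funext => y; rewrite fct_sumE -row_sum_delta.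
by apply: differentiable_sum => j; apply: differentiableZl.
Qed.

End CkTheory.

(** * Composition with coordinate maps, and block row vectors *)

(** A map [L] sending each coordinate direction to a coordinate direction or, for [None], to 0 turns
    partial derivatives into partial derivatives. The projection forgetting the radial coordinate
    and the slice of radius 1 are of this kind. *)
Lemma Ck_reindex (R : realType) (V : normedModType R) (m n k : nat)
    (L : 'rV[R]_n -> 'rV[R]_m) (s : 'I_n -> option 'I_m)
    (U : set 'rV[R]_m) (f : 'rV[R]_m -> V) : continuous L ->
  (forall h i y, L (h *: delta_mx 0 i + y) = h *: oapp (delta_mx 0) 0 (s i) + L y) ->
  open U -> Ck k U f -> Ck k (L @^-1` U) (fun y => f (L y)).
Proof.
move=> cL Ls oU.
have dL (f' : 'rV[R]_m -> V) i y : derivable f' (L y) (oapp (delta_mx 0) 0 (s i)) ->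
    derivable (fun y => f' (L y)) y (delta_mx 0 i) /\
    'D_(delta_mx 0 i) (fun y => f' (L y)) y = 'D_(oapp (delta_mx 0) 0 (s i)) f' (L y).
  rewrite /derivable /derive /=.
  under [X in _ -> cvg (X @ _) /\ _]funext do rewrite Ls.
  by under [X in _ -> _ /\ lim (X @ _) = _]funext do rewrite Ls.
elim: k f => [|k IH] f [cf df]; split=> //.
- by move=> y Uy; exact: (continuous_comp (cL y) (cf _ Uy)).
- by move=> y Uy; exact: (continuous_comp (cL y) (cf _ Uy)).
- move=> i; case E : (s i) => [j|].
    have [dj Dj] := df j; split=> [y Uy|].
      by apply: (dL _ _ _ _).1; rewrite E; exact: dj.
    apply: Ck_eq (open_comp _ oU) _ (IH _ Dj) => [y _|y Uy]; first exact: cL.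
    by rewrite (dL _ _ _ _).2 E //; exact: dj.
  split=> [y Uy|].
    by apply: (dL _ _ _ _).1; rewrite E; exact: derivable0.
  apply: Ck_eq (open_comp _ oU) _ (Ck_cst _ _ 0) => [y _|y Uy]; first exact: cL.
  by rewrite (dL _ _ _ _).2 E /= ?derive0 //; exact: derivable0.
Qed.

Lemma Ck_id (R : realType) (m k : nat) (U : set 'rV[R]_m) : Ck k U (fun x => x).
Proof.
case: k => [|k]; split=> //=; try by move=> x _; exact: cvg_id.
move=> i; split=> [x _|]; first exact: derivable_id.
have -> : (fun x : 'rV[R]_m => 'D_(delta_mx 0 i) (fun x => x) x) = (fun=> delta_mx 0 i).
  by apply/funext => x; exact: derive_id.
exact: Ck_cst.
Qed.

Lemma linear_rV_continuous (R : realType) (n : nat) (W : normedModType R)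
  (L : {linear 'rV[R]_n -> W}) : continuous L.
Proof.
move=> x; apply: differentiable_continuous.
have -> : (L : _ -> _) = \sum_j (fun y : 'rV[R]_n => (y 0 j : R) *: L (delta_mx 0 j)).
  apply/funext => y; rewrite fct_sumE [y in LHS]row_sum_delta linear_sum.
  by apply: eq_bigr => j _; rewrite linearZ.
by apply: differentiable_sum => j; apply/differentiableZl/differentiable_coord.
Qed.

Lemma derive_precomp (R : realType) (V V' W : normedModType R) (L : V' -> V)
    (f : V -> W) (y v : V') (w : V) :
  (forall h : R, L (h *: v + y) = h *: w + L y) ->
  (derivable f (L y) w -> derivable (f \o L) y v) /\
  'D_v (f \o L) y = 'D_w f (L y).
Proof.
move=> Lv; rewrite /derivable /derive.
suff -> : (fun h : R => h^-1 *: (((f \o L) \o shift y) (h *: v) - (f \o L) y)) =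
    (fun h => h^-1 *: ((f \o shift (L y)) (h *: w) - f (L y))) by [].
by apply/funext => h /=; rewrite Lv.
Qed.

Section Row.
Variables (R : realType) (n1 n2 : nat).

Definition inlx (a : 'rV[R]_n1) : 'rV[R]_(n1 + n2) := row_mx a 0.
Definition inrx (a : 'rV[R]_n2) : 'rV[R]_(n1 + n2) := row_mx 0 a.

Lemma inlx_linear : linear inlx.
Proof. by move=> k u v; rewrite /inlx scale_row_mx add_row_mx scaler0 addr0. Qed.

Lemma inrx_linear : linear inrx.
Proof. by move=> k u v; rewrite /inrx scale_row_mx add_row_mx scaler0 addr0. Qed.

HB.instance Definition _ := GRing.isLinear.Build _ _ _ _ inlx inlx_linear.
HB.instance Definition _ := GRing.isLinear.Build _ _ _ _ inrx inrx_linear.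

Lemma row_mxE (a : 'rV[R]_n1) (b : 'rV[R]_n2) : row_mx a b = inlx a + inrx b.
Proof. by rewrite /inlx /inrx add_row_mx addr0 add0r. Qed.

Lemma derive_row_mx (V : normedModType R) (A : V -> 'rV[R]_n1)
    (B : V -> 'rV[R]_n2) (x v : V) : derivable A x v -> derivable B x v ->
  'D_v (fun y => row_mx (A y) (B y)) x = row_mx ('D_v A x) ('D_v B x).
Proof.
move=> dA dB; under [X in 'D_v X _ = _]eq_fun do rewrite row_mxE.
have [dA' EA] := derive_lin (@linear_rV_continuous _ _ _ inlx) dA.
have [dB' EB] := derive_lin (@linear_rV_continuous _ _ _ inrx) dB.
by rewrite [LHS](deriveD dA' dB') EA EB -row_mxE.
Qed.

Lemma Ck_row_mx m k (U : set 'rV[R]_m) (A : 'rV[R]_m -> 'rV[R]_n1)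
    (B : 'rV[R]_m -> 'rV[R]_n2) : open U -> Ck k U A -> Ck k U B ->
  Ck k U (fun y => row_mx (A y) (B y)).
Proof.
move=> oU CA CB; under [X in Ck _ _ X]eq_fun do rewrite row_mxE.
apply: Ck_add => //.
  exact: (Ck_lin oU (@linear_rV_continuous _ _ _ inlx) CA).
exact: (Ck_lin oU (@linear_rV_continuous _ _ _ inrx) CB).
Qed.

End Row.

Lemma derive_addv (R : realType) (V W : normedModType R) (f : V -> W) (x u v : V) :
  differentiable f x -> 'D_(u + v) f x = 'D_u f x + 'D_v f x.
Proof. by move=> df; rewrite !deriveE // linearD. Qed.

Lemma derive_scalev (R : realType) (V W : normedModType R) (f : V -> W) (x v : V) a :
  differentiable f x -> 'D_(a *: v) f x = a *: 'D_v f x.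
Proof. by move=> df; rewrite !deriveE // linearZ. Qed.

Lemma derive_chain (R : realType) (V W X : normedModType R) (f : V -> W)
    (f' : W -> X) (x v : V) :
  differentiable f x -> differentiable f' (f x) ->
  'D_v (f' \o f) x = 'D_('D_v f x) f' (f x).
Proof.
move=> df df'; rewrite [LHS]deriveE; last exact: differentiable_comp.
by rewrite diff_comp //= [RHS]deriveE // [X in _ = 'd _ _ X]deriveE.
Qed.

(** * Vector fields and connections in charts *)

Section Fields.
Variables (R : realType) (m : nat) (M : charted R m).
Implicit Types (p q : M) (X Y : vfield M) (f : M -> R^o).

Definition overlap p q : set 'rV[R]_m :=
  coord (chart_at p) @` (dom (chart_at p) `&` dom (chart_at q)).

(* The part of [is_manifold] which the calculus of vector fields needs; it is
   stable under the passage to the cone. *)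
Definition C1_atlas : Prop :=
  (forall p, [/\ open (img (chart_at p)), dom (chart_at p) p &
     forall q, dom (chart_at p) q -> inv_coord (chart_at p) (coord (chart_at p) q) = q]) /\
  (forall p q, open (overlap p q) /\
     Ck 1 (overlap p q) (coord (chart_at q) \o inv_coord (chart_at p))).

Lemma manifold_C1_atlas : is_manifold M -> C1_atlas.
Proof.
move=> [_ _ _ Hc Ht]; split=> [p|p q].
  by have [[_ oi ik _ _] dp] := Hc p; split.
have op : open (overlap p q).
  have [[_ oi ik _ ci] dp] := Hc p; have [[od _ _ _ _] _] := Hc q.
  rewrite openE => x [r [rp rq] <-].
  have ir : img (chart_at p) (coord (chart_at p) r) by exists r.
  have := ci _ ir (dom (chart_at q)); rewrite ik // => /(_ (open_nbhs_nbhs (conj od rq))) N.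
  have N2 := nbhs_and (open_nbhs_nbhs (conj oi ir)) N.
  apply: nbhsS N2 => y [[s sp <-]] /=.
  by rewrite ik // => sq; exists s.
by split; [exact: op|exact: (Ht p q 1)].
Qed.

Hypothesis HM : C1_atlas.

Lemma img_open p : open (img (chart_at p)).
Proof. by have [/(_ p)[]] := HM. Qed.

Lemma img_self p : img (chart_at p) (coord (chart_at p) p).
Proof. by have [/(_ p)[_ d _] _] := HM; exists p. Qed.

Lemma img_nbhs p : nbhs (coord (chart_at p) p) (img (chart_at p)).
Proof. by apply: open_nbhs_nbhs; split; [exact: img_open|exact: img_self]. Qed.

Lemma coordK p q : dom (chart_at p) q ->
  inv_coord (chart_at p) (coord (chart_at p) q) = q.
Proof. by have [/(_ p)[_ _ H] _] := HM; exact: H. Qed.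

Lemma inv_coord_self p : inv_coord (chart_at p) (coord (chart_at p) p) = p.
Proof. by apply: coordK; have [/(_ p)[]] := HM. Qed.

Lemma img_dom p x : img (chart_at p) x -> dom (chart_at p) (inv_coord (chart_at p) x).
Proof. by case=> q dq <-; rewrite coordK. Qed.

Lemma inv_coordK p x : img (chart_at p) x ->
  coord (chart_at p) (inv_coord (chart_at p) x) = x.
Proof. by case=> q dq <-; rewrite coordK. Qed.

Lemma diff_overlap p q x : overlap p q x ->
  differentiable (coord (chart_at q) \o inv_coord (chart_at p)) x.
Proof. by move=> ox; have [op C1] := HM.2 p q; exact: (C1_differentiable op ox C1). Qed.

Lemma diff_trans p q : dom (chart_at p) q ->
  differentiable (coord (chart_at p) \o inv_coord (chart_at q)) (coord (chart_at q) q).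
Proof.
move=> dq; apply: diff_overlap; exists q => //; split=> //.
by have [/(_ q)[]] := HM.
Qed.

Lemma componentsD p X Y x : img (chart_at p) x ->
  components (chart_at p) (fun q => X q + Y q) x =
  components (chart_at p) X x + components (chart_at p) Y x.
Proof. by move=> /img_dom /diff_trans d; rewrite /components /dir derive_addv. Qed.

Lemma componentsZ p f X x : img (chart_at p) x ->
  components (chart_at p) (fun q => f q *: X q) x =
  f (inv_coord (chart_at p) x) *: components (chart_at p) X x.
Proof. by move=> /img_dom /diff_trans d; rewrite /components /dir derive_scalev. Qed.

Lemma components_self p X :
  components (chart_at p) X (coord (chart_at p) p) = X p.
Proof.
rewrite /components /dir inv_coord_self.
rewrite -[RHS](@derive_id R 'rV[R]_m (coord (chart_at p) p)).
apply: near_eq_derive; apply: nbhsS (img_nbhs p) => x ix.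
by rewrite /= inv_coordK.
Qed.

Lemma smooth_nearP (V : normedModType R) p (F F' : 'rV[R]_m -> V) :
  (forall x, img (chart_at p) x -> F x = F' x) ->
  smooth_near p F -> smooth_near p F'.
Proof.
move=> E [U [oU Ui Up] sF]; exists U => // k.
by apply: Ck_eq oU _ (sF k) => x /Ui; exact: E.
Qed.

Lemma smooth_near2 (V V' W : normedModType R) p (F : 'rV[R]_m -> V)
    (F' : 'rV[R]_m -> V') (F'' : 'rV[R]_m -> W) :
  (forall k U, open U -> Ck k U F -> Ck k U F' -> Ck k U F'') ->
  smooth_near p F -> smooth_near p F' -> smooth_near p F''.
Proof.
move=> H [U [oU Ui Up] sF] [U' [oU' Ui' Up'] sF'].
exists (U `&` U').
  by split=> //; [exact: openI|move=> x [/Ui]].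
move=> k; apply: (H); first exact: openI.
- by apply: Ck_sub (sF k) => x [].
- by apply: Ck_sub (sF' k) => x [].
Qed.

Lemma smooth_fieldD p X Y : smooth_field X p -> smooth_field Y p ->
  smooth_field (fun q => X q + Y q) p.
Proof.
move=> sX sY.
have /smooth_nearP : forall x, img (chart_at p) x ->
  components (chart_at p) X x + components (chart_at p) Y x =
  components (chart_at p) (fun q => X q + Y q) x by move=> x /componentsD.
apply; apply: smooth_near2 sX sY => k U oU; exact: Ck_add.
Qed.

Lemma smooth_fieldZ p f X : smooth_fun f p -> smooth_field X p ->
  smooth_field (fun q => f q *: X q) p.
Proof.
move=> sf sX.
have /smooth_nearP : forall x, img (chart_at p) x ->
  (f \o inv_coord (chart_at p)) x *: components (chart_at p) X x =
  components (chart_at p) (fun q => f q *: X q) x by move=> x /componentsZ.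
apply; apply: smooth_near2 sf sX => k U oU; exact: Ck_scale.
Qed.

Lemma smooth_near_cst (V : normedModType R) p (a : V) : smooth_near p (fun=> a).
Proof.
exists (img (chart_at p)); first by split; [exact: img_open| |exact: img_self].
by move=> k; exact: Ck_cst.
Qed.

Lemma smooth_fun_cst (a : R^o) p : smooth_fun (fun=> a) p.
Proof. exact: smooth_near_cst. Qed.

Lemma smooth_fieldZc p (a : R) X : smooth_field X p ->
  smooth_field (fun q => a *: X q) p.
Proof. by apply: smooth_fieldZ (smooth_fun_cst a p). Qed.

Lemma smooth_fieldN p X : smooth_field X p -> smooth_field (fun q => - X q) p.
Proof.
move=> sX; have -> : (fun q => - X q) = (fun q => -1 *: X q).
  by apply/funext => q; rewrite scaleN1r.
exact: smooth_fieldZc.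
Qed.

Lemma smooth_field0 p : smooth_field (fun=> 0 : 'rV[R]_m) p.
Proof.
apply: (smooth_nearP _ (smooth_near_cst p 0)) => x _.
by rewrite /components /dir derive0.
Qed.

Definition extension p (w : 'rV[R]_m) : vfield M := fun q =>
  'D_w (coord (chart_at q) \o inv_coord (chart_at p)) (coord (chart_at p) q).

(** The two transition maps between the charts at [p] and [q] are mutually inverse near [x], so by
    the chain rule the two conversions of [w] cancel. *)
Lemma components_extension p w x : img (chart_at p) x ->
  components (chart_at p) (extension p w) x = w.
Proof.
move=> ix; rewrite /components /dir /extension inv_coordK //.
set q := inv_coord _ x.
have dq := img_dom ix; have oq := (HM.2 p q).1.
have ox : overlap p q x.
  by exists q; [split=> //; have [/(_ q)[]] := HM|exact: inv_coordK].
rewrite -[RHS](@derive_id R 'rV[R]_m x).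
rewrite -[coord (chart_at q) q]/((coord (chart_at q) \o inv_coord (chart_at p)) x).
rewrite -derive_chain; last 2 first.
- exact: diff_overlap.
- exact: diff_trans.
apply: near_eq_derive; apply: (near_open oq ox) => y [r [rp rq] <-] /=.
by rewrite coordK // coordK.
Qed.

Lemma smooth_extension p w : smooth_field (extension p w) p.
Proof.
apply: smooth_nearP (smooth_near_cst p w) => x ix.
by rewrite components_extension.
Qed.

Lemma extension_self p w : extension p w p = w.
Proof. by rewrite -components_self components_extension //; exact: img_self. Qed.

Lemma smooth_fun_diff f p : smooth_fun f p ->
  differentiable (f \o inv_coord (chart_at p)) (coord (chart_at p) p).
Proof. by move=> [U [oU _ Up] sf]; exact: (C1_differentiable_real oU Up (sf 1%N)). Qed.

Lemma smooth_field_diff X p : smooth_field X p ->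
  differentiable (components (chart_at p) X) (coord (chart_at p) p).
Proof. by move=> [U [oU _ Up] sf]; exact: (C1_differentiable oU Up (sf 1%N)). Qed.

Section Connection.
Variable D : vfield M -> endfield M.
Hypothesis HD : is_connection D.

Lemma conn_smooth X Y p : smooth_field X p -> smooth_field Y p ->
  smooth_field (fun q => D X q (Y q)) p.
Proof. by have [H _ _] := HD; exact: H. Qed.

Lemma connD X Y p v : smooth_field X p -> smooth_field Y p ->
  D (fun q => X q + Y q) p v = D X p v + D Y p v.
Proof. by have [_ H _] := HD => sX sY; rewrite H // add_lfunE. Qed.

Lemma connZ f X p v : smooth_fun f p -> smooth_field X p ->
  D (fun q => f q *: X q) p v = dir f p v *: X p + f p *: D X p v.
Proof. by have [_ _ H] := HD => sf sX; exact: H. Qed.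

Lemma dir_cst (a : R^o) p v : dir (fun=> a) p v = 0.
Proof. exact: derive_cst. Qed.

Lemma connZc a X p v : smooth_field X p -> D (fun q => a *: X q) p v = a *: D X p v.
Proof.
by move=> sX; rewrite (connZ v (smooth_fun_cst a p) sX) dir_cst scale0r add0r.
Qed.

Lemma conn0 p : D (fun=> 0 : 'rV[R]_m) p = 0.
Proof.
apply/lfunP => v; have := connZc 0 v (smooth_field0 p).
rewrite (_ : (fun q => _) = (fun=> 0)); last by apply/funext => q; rewrite scaler0.
by move=> ->; rewrite scale0r zero_lfunE.
Qed.

Lemma connN X p v : smooth_field X p -> D (fun q => - X q) p v = - D X p v.
Proof.
move=> sX; rewrite -scaleN1r -connZc //.
by congr (D _ p v); apply/funext => q; rewrite scaleN1r.
Qed.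

(* No bump function is needed: the indicator function of a neighbourhood of [p]
   is smooth near [p]. *)
Lemma conn_local (U : set 'rV[R]_m) X Y p : open U -> U (coord (chart_at p) p) ->
  (forall q, dom (chart_at p) q -> U (coord (chart_at p) q) -> X q = Y q) ->
  smooth_field X p -> smooth_field Y p -> D X p = D Y p.
Proof.
move=> oU Up XY sX sY.
pose f : M -> R^o := fun q =>
  if `[< dom (chart_at p) q /\ U (coord (chart_at p) q) >] then 1 else 0.
pose V := U `&` img (chart_at p).
have oV : open V by apply: openI => //; exact: img_open.
have Vp : V (coord (chart_at p) p) by split=> //; exact: img_self.
have f1 x : V x -> (f \o inv_coord (chart_at p)) x = 1.
  move=> [Ux ix]; rewrite /f /=; case: asboolP => // -[]; split.
    exact: img_dom.
  by rewrite inv_coordK.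
have fp : f p = 1 by rewrite -[RHS](f1 _ Vp) /= inv_coord_self.
have sf : smooth_fun f p.
  exists V => [|k]; first by split=> // x [].
  by apply: Ck_eq oV _ (Ck_cst k V (1 : R^o)) => x /f1.
have df v : dir f p v = 0.
  rewrite /dir -[RHS](@derive_cst R _ _ (1 : R^o) (coord (chart_at p) p) v).
  by apply: near_eq_derive; apply: (near_open oV Vp) => x /f1.
have fXY : (fun q => f q *: X q) = (fun q => f q *: Y q).
  apply/funext => q; rewrite /f; case: asboolP => [[dq Uq]|_].
    by rewrite (XY q).
  by rewrite !scale0r.
apply/lfunP => v.
have := connZ v sf sX; rewrite fXY (connZ v sf sY) df fp !scale0r !add0r !scale1r.
by move=> ->.
Qed.

End Connection.
End Fields.

(** * Inner products and the charts of the cone *)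

Section InnerProduct.
Variables (R : realType) (m : nat).
Implicit Types (h : 'M[R]_m) (u v w : 'rV[R]_m).

Lemma ipDl h u v w : ip h (u + v) w = ip h u w + ip h v w.
Proof. by rewrite /ip !mulmxDl mxE. Qed.

Lemma ipDr h u v w : ip h w (u + v) = ip h w u + ip h w v.
Proof. by rewrite /ip linearD mulmxDr mxE. Qed.

Lemma ipZl h a u w : ip h (a *: u) w = a * ip h u w.
Proof. by rewrite /ip -!scalemxAl mxE. Qed.

Lemma ipZr h a u w : ip h w (a *: u) = a * ip h w u.
Proof. by rewrite /ip linearZ -scalemxAr mxE. Qed.

Lemma ipNl h u w : ip h (- u) w = - ip h u w.
Proof. by rewrite -scaleN1r ipZl mulN1r. Qed.

Lemma ipNr h u w : ip h w (- u) = - ip h w u.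
Proof. by rewrite -scaleN1r ipZr mulN1r. Qed.

Lemma ip0l h w : ip h 0 w = 0.
Proof. by rewrite -(scale0r (0 : 'rV[R]_m)) ipZl mul0r. Qed.

Lemma ip0r h w : ip h w 0 = 0.
Proof. by rewrite -(scale0r (0 : 'rV[R]_m)) ipZr mul0r. Qed.

Lemma ipC h u v : h^T = h -> ip h u v = ip h v u.
Proof.
move=> hT; have E (A : 'M[R]_1) : A 0 0 = A^T 0 0 by rewrite mxE.
by rewrite /ip E !trmx_mul trmxK hT mulmxA.
Qed.

Lemma ip_eq0 h u : h \in unitmx -> (forall v, ip h u v = 0) -> u = 0.
Proof.
move=> hu H; suff uh0 : u *m h = 0 by rewrite -[u](mulmxK hu) uh0 mul0mx.
apply/rowP => j; have := H (delta_mx 0 j).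
rewrite /ip mxE (bigD1 j) //= big1 ?addr0 => [|i ij]; last first.
  by rewrite !mxE (negPf ij) mulr0.
by rewrite !mxE !eqxx mulr1.
Qed.

Lemma ip_inj h u v : h \in unitmx -> (forall w, ip h u w = ip h v w) -> u = v.
Proof.
move=> hu H; apply/eqP; rewrite -subr_eq0; apply/eqP/(ip_eq0 hu) => w.
by rewrite ipDl ipNl H subrr.
Qed.

Definition ipE := (ipDl, ipDr, ipZl, ipZr, ipNl, ipNr, ip0l, ip0r).

End InnerProduct.

Lemma half_line_gt0 (R : realType) (s : half_line R) : 0 < val s.
Proof. by case: s => r r0; have := set_mem r0. Qed.

Lemma val_half_line (R : realType) (r : R) :
  0 < r -> val (insubd (half_line1 R) r) = r.
Proof. by move=> r0; rewrite insubdK // inE. Qed.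

Lemma const_mx1 (R : realType) (a : R) : const_mx a = a%:M :> 'M[R]_1.
Proof. by apply/matrixP => i j; rewrite !mxE !ord1. Qed.

Lemma delta_lshift (R : realType) (n1 n2 : nat) (i : 'I_n1) :
  delta_mx 0 (lshift n2 i) = row_mx (delta_mx 0 i) 0 :> 'rV[R]_(n1 + n2).
Proof.
apply/rowP => j; rewrite mxE; case: (split_ordP j) => k ->.
  by rewrite row_mxEl mxE (inj_eq (@lshift_inj _ _)).
by rewrite row_mxEr mxE eq_rlshift andbF.
Qed.

Lemma delta_rshift (R : realType) (n1 n2 : nat) (i : 'I_n2) :
  delta_mx 0 (rshift n1 i) = row_mx 0 (delta_mx 0 i) :> 'rV[R]_(n1 + n2).
Proof.
apply/rowP => j; rewrite mxE; case: (split_ordP j) => k ->.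
  by rewrite row_mxEl mxE eq_lrshift andbF.
by rewrite row_mxEr mxE (inj_eq (@rshift_inj _ _)).
Qed.

Lemma Ck_rsubmx (R : realType) (n1 n2 k : nat) (V : normedModType R)
    (U : set 'rV[R]_n2) (f : 'rV[R]_n2 -> V) : open U -> Ck k U f ->
  Ck k (rsubmx @^-1` U) (fun x : 'rV[R]_(n1 + n2) => f (rsubmx x)).
Proof.
pose s (i : 'I_(n1 + n2)) :=
  match fintype.split i with inl _ => None | inr j => Some j end.
move=> oU; apply: (@Ck_reindex _ _ _ _ _ rsubmx s) => //.
  exact: continuous_rsubmx.
move=> h i y; rewrite linearD linearZ /=; congr (_ *: _ + _).
rewrite /s; case: split_ordP => j ->.
  by rewrite delta_lshift row_mxKr.
by rewrite delta_rshift row_mxKr.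
Qed.

Section ConeCharts.
Variables (R : realType) (m : nat) (M : charted R m).
Implicit Types (z : cone M) (a b : R) (v w : 'rV[R]_m).

Definition cset (A : set 'rV[R]_m) : set 'rV[R]_(1 + m) :=
  [set x | 0 < lsubmx x 0 0] `&` (rsubmx @^-1` A).

Lemma cset_open A : open A -> open (cset A).
Proof.
move=> oA; apply: openI; last first.
  by apply: open_comp => // x _; exact: continuous_rsubmx.
apply: (@open_comp _ _ (fun x : 'rV[R]_(1 + m) => lsubmx x 0 0) [set r | 0 < r]).
  move=> x _; apply: (@continuous_comp _ _ _ lsubmx (fun N : 'rV[R]_1 => N 0 0)).
    exact: continuous_lsubmx.
  exact: coord_continuous.
exact: open_gt.
Qed.

Lemma cset_coord (A : set M) (c : chart R m M) :
  coord (cone_chart c) @` ([set: half_line R] `*` A) = cset (coord c @` A).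
Proof.
apply/seteqP; split=> [_ [y [_ Ay] <-]|x [x0 [q Aq qx]]].
  split; rewrite /= ?row_mxKl ?row_mxKr; first by rewrite mxE half_line_gt0.
  by exists y.2.
exists (insubd (half_line1 R) (lsubmx x 0 0), q) => //=.
by rewrite val_half_line // qx const_mx1 -mx11_scalar hsubmxK.
Qed.

Lemma img_cone z : img (chart_at z) = cset (img (chart_at z.2)).
Proof. exact: cset_coord. Qed.

Hypothesis HM : C1_atlas M.

(** A transition map of the cone is the identity in the radial coordinate times a transition map of
    M; the default value in [insubd] is never reached on an overlap, where the radial coordinate is
    positive. *)
Lemma cone_C1_atlas : C1_atlas (cone M).
Proof.
split=> [z|z z'].
  split; first by rewrite img_cone; apply/cset_open/img_open.
    by split=> //; have [/(_ z.2)[]] := HM.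
  move=> [s q] [_ dq] /=; rewrite row_mxKl row_mxKr coordK // mxE.
  by congr pair; apply/val_inj/val_half_line/half_line_gt0.
have E : overlap z z' = cset (overlap z.2 z'.2).
  rewrite /overlap -cset_coord; congr (_ @` _); apply/seteqP.
  by split=> [[s q] [[_ ? [_ ?]]]|[s q] [_ [? ?]]].
have o : open (overlap z z') by rewrite E; apply/cset_open/(HM.2 _ _).1.
split; first exact: o.
pose F (x : 'rV[R]_(1 + m)) := row_mx (lsubmx x)
  ((coord (chart_at z'.2) \o inv_coord (chart_at z.2)) (rsubmx x)).
have CF : Ck 1 (overlap z z') F.
  apply: Ck_row_mx.
    exact: o.
    exact: (Ck_lin (L := lsubmx) o (@continuous_lsubmx _ _ _ _) (@Ck_id _ _ _ _)).
  apply: Ck_sub (Ck_rsubmx _ (HM.2 z.2 z'.2).1 (HM.2 z.2 z'.2).2).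
  by rewrite E => x [].
apply: Ck_eq o _ CF => x.
rewrite E => -[x0 _]; rewrite /F /= val_half_line // const_mx1.
by rewrite -mx11_scalar.
Qed.

End ConeCharts.

(** * Vector fields on the cone *)

Section ConeFields.
Variables (R : realType) (m : nat) (M : charted R m).
Hypothesis HM : C1_atlas M.
Implicit Types (z : cone M) (a b : R) (v w : 'rV[R]_m) (X Y : vfield M).

Let HC := cone_C1_atlas HM.

(* The tangent vector [a d/dr + v] of the cone. *)
Definition cvec a v : 'rV[R]_(1 + m) := row_mx a%:M v.

Definition radius z : R := val z.1.

(** Fields with a constant radial coefficient fill every tangent space and have explicit brackets
    and inner products, so testing against them determines the connection of the cone. *)
Definition cfield a X : vfield (cone M) := fun z => cvec a (X z.2).

Definition radial : vfield (cone M) := fun z => cvec (radius z) 0.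

Lemma radius_gt0 z : 0 < radius z.
Proof. exact: half_line_gt0. Qed.

Lemma cvecP (x : 'rV[R]_(1 + m)) : x = cvec (lsubmx x 0 0) (rsubmx x).
Proof. by rewrite /cvec -mx11_scalar hsubmxK. Qed.

Lemma cvecD a v b w : cvec a v + cvec b w = cvec (a + b) (v + w).
Proof. by rewrite /cvec add_row_mx raddfD. Qed.

Lemma cvecZ a b w : a *: cvec b w = cvec (a * b) (a *: w).
Proof. by rewrite /cvec scale_row_mx scale_scalar_mx. Qed.

Lemma cvecN b w : - cvec b w = cvec (- b) (- w).
Proof. by rewrite -scaleN1r cvecZ mulN1r scaleN1r. Qed.

Lemma cvec0 : cvec 0 0 = 0.
Proof. by rewrite /cvec raddf0 row_mx0. Qed.

Lemma cvec0l v : cvec 0 v = row_mx 0 v.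
Proof. by rewrite /cvec raddf0. Qed.

Lemma cvec_inj a v b w : cvec a v = cvec b w -> a = b /\ v = w.
Proof.
move=> /eq_row_mx[/matrixP/(_ 0 0) + ->]; rewrite !mxE eqxx !mulr1n.
by move=> ->.
Qed.

Lemma cone_liftE X : cone_lift X = cfield 0 X.
Proof. by apply/funext => z; rewrite /cone_lift /cfield /cvec raddf0. Qed.

Lemma ip_cone (g : M -> 'M[R]_m) z a v b w :
  ip (cone_metric g z) (cvec a v) (cvec b w) = a * b + radius z ^+ 2 * ip (g z.2) v w.
Proof.
rewrite /ip /cone_metric /cvec mul_row_block !mulmx0 addr0 add0r mulmx1.
rewrite tr_row_mx mul_row_col mxE -scalemxAr -scalemxAl [X in _ + X]mxE.
by rewrite tr_scalar_mx mul_scalar_mx !mxE eqxx mulr1n.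
Qed.

Lemma coordE z : coord (chart_at z) z = cvec (radius z) (coord (chart_at z.2) z.2).
Proof. by rewrite /= const_mx1. Qed.

Lemma inv_cone_1 z x : img (chart_at z) x ->
  radius (inv_coord (chart_at z) x) = lsubmx x 0 0.
Proof. by rewrite img_cone => -[x0 _]; exact: val_half_line. Qed.

Lemma smooth_near_cone (V : normedModType R) z (F : 'rV[R]_m -> V) :
  smooth_near z.2 F -> smooth_near z (fun x => F (rsubmx x)).
Proof.
move=> [U [oU Ui Up] sF]; exists (cset U) => [|k].
  split; first exact: cset_open.
    by rewrite img_cone => x [x0 /Ui].
  rewrite coordE /cvec; split; rewrite /= ?row_mxKl ?row_mxKr //.
  by rewrite mxE eqxx mulr1n radius_gt0.
by apply: Ck_sub (Ck_rsubmx _ oU (sF k)) => x [].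
Qed.

Lemma derive_rsubmx (V : normedModType R) (F : 'rV[R]_m -> V)
    (x y : 'rV[R]_(1 + m)) : differentiable F (rsubmx x) ->
  derivable (F \o rsubmx) x y /\
  'D_y (F \o rsubmx) x = 'D_(rsubmx y) F (rsubmx x).
Proof.
move=> dF; have [d E] := @derive_precomp _ _ _ _ (rsubmx : 'rV[R]_(1 + m) -> _) F x y (rsubmx y)
   (fun h => linearP rsubmx h y x).
by split=> //; apply: d; exact: diff_derivable.
Qed.

(** Changes of chart do not touch the radial direction, so the remaining components are those of a
    field on M obtained by freezing the radius. *)
Lemma components_cone z (F : vfield (cone M)) x : img (chart_at z) x ->
  components (chart_at z) F x =
  row_mx (lsubmx (F (inv_coord (chart_at z) x)))
    (components (chart_at z.2) (fun q => rsubmx (F ((inv_coord (chart_at z) x).1, q)))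
       (rsubmx x)).
Proof.
move=> ix; have ix' : img (chart_at z.2) (rsubmx x) by move: ix; rewrite img_cone => -[].
rewrite /components /dir; set z' := inv_coord _ x.
have -> : inv_coord (chart_at z.2) (rsubmx x) = z'.2 by [].
have -> : (z'.1, z'.2) = z' by case: z'.
have dz' : dom (chart_at z.2) z'.2 by exact: img_dom.
set w := F z'.
have dT := diff_trans HM dz'.
set T := coord _ \o _ in dT *.
pose G (y : 'rV[R]_(1 + m)) := row_mx (lsubmx y) (T (rsubmx y)).
transitivity ('D_w G (coord (chart_at z') z')).
  apply: near_eq_derive; apply: nbhsS (img_nbhs HC z') => y iy.
  rewrite /G /=.
  have -> : val (insubd (half_line1 R) (lsubmx y 0 0)) = lsubmx y 0 0.
    by have := inv_cone_1 iy.
  by rewrite const_mx1 -mx11_scalar.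
have E : rsubmx (coord (chart_at z') z') = coord (chart_at z'.2) z'.2.
  by rewrite coordE row_mxKr.
have [d1 d2] : derivable (T \o rsubmx) (coord (chart_at z') z') w /\
  'D_w (T \o rsubmx) (coord (chart_at z') z') = 'D_(rsubmx w) T (coord (chart_at z'.2) z'.2).
  by rewrite -E; apply: derive_rsubmx; rewrite E.
rewrite derive_row_mx; last first.
- exact: d1.
- exact/diff_derivable/differentiable_lsubmx.
congr row_mx; last exact: d2.
have [_ ->] := @derive_lin _ _ _ _ lsubmx id (coord (chart_at z') z') w
  (@continuous_lsubmx _ _ _ _) (@derivable_id R _ _ _).
by rewrite derive_id.
Qed.

Lemma smooth_near_global (V : normedModType R) z (F : 'rV[R]_(1 + m) -> V) :
  (forall k U, open U -> Ck k U F) -> smooth_near z F.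
Proof.
move=> CF; exists (img (chart_at z)).
  by split=> //; [exact: (img_open HC)|exact: (img_self HC)].
by move=> k; apply: CF; exact: (img_open HC).
Qed.

Lemma components_cfield z a X x : img (chart_at z) x ->
  components (chart_at z) (cfield a X) x =
  cvec a (components (chart_at z.2) X (rsubmx x)).
Proof.
move=> ix; rewrite (components_cone _ ix) [cfield a X _]/cvec row_mxKl /cvec.
have -> // : (fun q => rsubmx (cfield a X ((inv_coord (chart_at z) x).1, q))) = X.
by apply/funext => q; rewrite /cfield /cvec row_mxKr.
Qed.

Lemma components_radial z x : img (chart_at z) x ->
  components (chart_at z) radial x = row_mx (lsubmx x) 0.
Proof.
move=> ix; rewrite (components_cone _ ix) [radial _]/cvec row_mxKl (inv_cone_1 ix).
rewrite -mx11_scalar; congr row_mx; rewrite /components /dir.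
by rewrite [radial _]/cvec row_mxKr derive0.
Qed.

Lemma smooth_cfield z a X : smooth_field X z.2 -> smooth_field (cfield a X) z.
Proof.
move=> sX.
have /smooth_nearP : forall x, img (chart_at z) x ->
  cvec a (components (chart_at z.2) X (rsubmx x)) =
  components (chart_at z) (cfield a X) x by move=> x /components_cfield.
apply; apply: smooth_near2 (smooth_near_cst HC z (a%:M : 'rV[R]_1)) (smooth_near_cone sX).
by move=> k U oU C1 C2; exact: (Ck_row_mx oU C1 C2).
Qed.

Lemma smooth_radial z : smooth_field radial z.
Proof.
have /smooth_nearP : forall x, img (chart_at z) x ->
  row_mx (lsubmx x) 0 = components (chart_at z) radial x.
  by move=> x /components_radial.
apply; apply: smooth_near_global => k U oU; apply: (Ck_row_mx oU).
  exact: (Ck_lin (L := lsubmx) oU (@continuous_lsubmx _ _ _ _) (@Ck_id _ _ _ _)).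
exact: Ck_cst.
Qed.

Lemma smooth_fun_cone (f : M -> R^o) z :
  smooth_fun f z.2 -> smooth_fun (fun z' : cone M => f z'.2) z.
Proof. by move=> sf; exact: (smooth_near_cone sf). Qed.

Lemma dir_cone (f : M -> R^o) z a v : smooth_fun f z.2 ->
  dir (fun z' : cone M => f z'.2 : R^o) z (cvec a v) = dir f z.2 v.
Proof.
move=> /(smooth_fun_diff) df; rewrite /dir.
have E : rsubmx (coord (chart_at z) z) = coord (chart_at z.2) z.2.
  by rewrite coordE row_mxKr.
rewrite -E in df; have [_] := derive_rsubmx (cvec a v) df.
by rewrite E /cvec row_mxKr.
Qed.

Lemma derive_lsubmx00 (x w : 'rV[R]_(1 + m)) :
  derivable (fun y : 'rV[R]_(1 + m) => lsubmx y 0 0 : R^o) x w /\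
  'D_w (fun y : 'rV[R]_(1 + m) => lsubmx y 0 0 : R^o) x = lsubmx w 0 0.
Proof.
pose l (y : 'rV[R]_(1 + m)) : R^o := lsubmx y 0 0.
have ll (h : R) : l (h *: w + x) = h *: l w + l x by rewrite /l !mxE.
have [d E] := @derive_precomp _ _ _ _ l id x w (l w) ll.
by split; [exact: (d (@derivable_id R _ _ _))|rewrite [LHS]E derive_id].
Qed.

Lemma smooth_radius z : smooth_fun (radius : cone M -> R^o) z.
Proof.
have /smooth_nearP : forall x, img (chart_at z) x -> (lsubmx x 0 0 : R^o) =
   ((radius : cone M -> R^o) \o inv_coord (chart_at z)) x.
  by move=> x /inv_cone_1.
apply; apply: (smooth_near_global) => k U oU.
pose l (N : 'rV[R]_1) : R^o := N 0 0.
have ll : linear l by move=> c u v; rewrite /l !mxE.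
pose LM := GRing.isLinear.Build _ _ _ _ l ll.
pose L : {linear 'rV[R]_1 -> R^o} := HB.pack l LM.
apply: (Ck_lin (L := L) oU (@linear_rV_continuous _ _ _ L)).
exact: (Ck_lin (L := lsubmx) oU (@continuous_lsubmx _ _ _ _) (@Ck_id _ _ _ _)).
Qed.

Lemma dir_radius z a v : dir (radius : cone M -> R^o) z (cvec a v) = a.
Proof.
have [_ E] := derive_lsubmx00 (coord (chart_at z) z) (cvec a v).
rewrite -[RHS]/(a) -[a in RHS](_ : lsubmx (cvec a v) 0 0 = a); last first.
  by rewrite /cvec row_mxKl mxE eqxx mulr1n.
rewrite -E; apply: near_eq_derive; apply: nbhsS (img_nbhs HC z) => x ix.
exact: inv_cone_1.
Qed.

(** The inner product of two fields [cfield] has the form [c + r^2 f]; this is the left side of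
    metric compatibility on the cone. *)
Lemma dir_warped (f : M -> R^o) c z a v : smooth_fun f z.2 ->
  dir (fun z' : cone M => c + radius z' ^+ 2 * f z'.2 : R^o) z (cvec a v) =
  2 * radius z * a * f z.2 + radius z ^+ 2 * dir f z.2 v.
Proof.
move=> sf; have df := smooth_fun_diff sf.
have E : rsubmx (coord (chart_at z) z) = coord (chart_at z.2) z.2.
  by rewrite coordE row_mxKr.
rewrite -E in df; have [dF EF] := derive_rsubmx (cvec a v) df.
have [dl El] := derive_lsubmx00 (coord (chart_at z) z) (cvec a v).
pose l (y : 'rV[R]_(1 + m)) : R := lsubmx y 0 0.
pose F (y : 'rV[R]_(1 + m)) : R := (f \o inv_coord (chart_at z.2)) (rsubmx y).
rewrite [LHS]/dir.
transitivity ('D_(cvec a v) (fun y => c + (l * (l * F)) y) (coord (chart_at z) z)).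
  apply: near_eq_derive; apply: nbhsS (img_nbhs HC z) => x ix.
  rewrite /= inv_cone_1 // expr2 -mulrA; congr (_ + _ * (_ * _)).
have dlF := @derivableM _ _ l F (coord (chart_at z) z) (cvec a v) dl dF.
have dllF := @derivableM _ _ l (l * F) (coord (chart_at z) z) (cvec a v) dl dlF.
rewrite (@deriveD _ _ _ (cst c) (l * (l * F)) _ _ (@derivable_cst _ _ _ c _ _) dllF).
rewrite derive_cst add0r (@deriveM _ _ l (l * F) _ _ dl dlF) (@deriveM _ _ l F _ _ dl dF).
have El' : 'D_(cvec a v) l (coord (chart_at z) z) = a.
  by rewrite [LHS]El /cvec row_mxKl mxE eqxx mulr1n.
have EF' : 'D_(cvec a v) F (coord (chart_at z) z) = dir f z.2 v.
  by rewrite [LHS]EF E /cvec row_mxKr.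
have lE : l (coord (chart_at z) z) = radius z.
  by rewrite /l coordE /cvec row_mxKl mxE eqxx mulr1n.
have FE : F (coord (chart_at z) z) = f z.2.
  by rewrite /F E /= (inv_coord_self HM).
rewrite El' EF'.
have -> : (l * F) (coord (chart_at z) z) = radius z * f z.2 by rewrite -lE -FE.
rewrite lE FE /GRing.scale /=.
ring.
Qed.

Lemma derive_components_cfield z a X (w : 'rV[R]_(1 + m)) : smooth_field X z.2 ->
  'D_w (components (chart_at z) (cfield a X)) (coord (chart_at z) z) =
  cvec 0 ('D_(rsubmx w) (components (chart_at z.2) X) (coord (chart_at z.2) z.2)).
Proof.
move=> /(smooth_field_diff) dX.
have E : rsubmx (coord (chart_at z) z) = coord (chart_at z.2) z.2.
  by rewrite coordE row_mxKr.
rewrite -E in dX; have [dF EF] := derive_rsubmx w dX.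
transitivity ('D_w (fun x => row_mx (cst (a%:M : 'rV_1) x)
    ((components (chart_at z.2) X \o rsubmx) x)) (coord (chart_at z) z)).
  apply: near_eq_derive; apply: nbhsS (img_nbhs HC z) => x ix.
  by rewrite components_cfield.
rewrite derive_row_mx; last first.
- exact: dF.
- exact: derivable_cst.
by rewrite derive_cst EF E /cvec raddf0.
Qed.

Lemma bracket_cfield z a b X Y : smooth_field X z.2 -> smooth_field Y z.2 ->
  bracket (cfield a X) (cfield b Y) z = cvec 0 (bracket X Y z.2).
Proof.
move=> sX sY.
have E1 := derive_components_cfield b (cfield a X z) sY.
have E2 := derive_components_cfield a (cfield b Y z) sX.
apply: (etrans (congr2 (fun x y => x - y) E1 E2)).
by rewrite /cfield /cvec !row_mxKr cvecN cvecD oppr0 addr0.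
Qed.

End ConeFields.

(** * The Levi-Civita connection of the cone *)

(** Alternating the two exchanges, [ijk], [jik], [jki], [kji], [kij], [ikj], [ijk], returns to the
    start after three sign changes. This is the argument behind the uniqueness of the Levi-Civita
    connection; [P] selects the admissible arguments. *)
Lemma braid_eq0 (R : realType) (I : Type) (P : I -> Prop) (t : I -> I -> I -> R) :
  (forall i j k, P i -> P j -> P k -> t i j k = t j i k) ->
  (forall i j k, P i -> P j -> P k -> t i j k = - t i k j) ->
  forall i j k, P i -> P j -> P k -> t i j k = 0.
Proof.
move=> sym alt i j k Pi Pj Pk.
have : t i j k = - t i j k.
  by rewrite {1}sym // alt // sym // alt // opprK sym // alt.
by lra.
Qed.

(** * Covariant derivatives of skew endomorphism fields *)

Section LeviCivita.
Variables (R : realType) (m : nat) (M : charted R m).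
Variables (g : M -> 'M[R]_m) (D : vfield M -> endfield M).
Hypotheses (HM : C1_atlas M) (gT : forall p, (g p)^T = g p)
  (gU : forall p, g p \in unitmx) (HD : levi_civita g D).
Implicit Types (p : M) (X Y V W : vfield M) (J K L : endfield M).

Let Hconn : is_connection D. Proof. by case: HD. Qed.

Lemma torsion_free p X Y : smooth_field X p -> smooth_field Y p ->
  bracket X Y p = D Y p (X p) - D X p (Y p).
Proof. by have [_ H _] := HD => sX sY; rewrite H. Qed.

Lemma metric_compatible p X Y v : smooth_field X p -> smooth_field Y p ->
  dir (fun q => ip (g q) (X q) (Y q) : R^o) p v =
  ip (g p) (D X p v) (Y p) + ip (g p) (X p) (D Y p v).
Proof. by have [_ _ H] := HD => sX sY; exact: H. Qed.

(** Metric compatibility and vanishing torsion turn the Lie derivative of [g] along [T] into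
    g(nabla_X T, Y) + g(X, nabla_Y T). *)
Lemma killing_skewP T : smooth_vfield T -> killing g T <-> skew g (D T).
Proof.
move=> sT; split=> [kT p u v|kT p X Y sX sY].
  have sE w := smooth_extension HM p w; have := kT p _ _ (sE u) (sE v).
  rewrite (metric_compatible _ (sE u) (sE v)) !(torsion_free (sT p) (sE _)).
  by rewrite !(extension_self HM) !ipE; lra.
rewrite (metric_compatible _ sX sY) (torsion_free (sT p) sX) (torsion_free (sT p) sY).
by rewrite !ipE kT; lra.
Qed.

Definition smooth_endo J := forall p X, smooth_field X p ->
  smooth_field (fun q => J q (X q)) p.

Lemma smooth_endo_conn T : smooth_vfield T -> smooth_endo (D T).
Proof. by move=> sT p X sX; exact: (conn_smooth Hconn (sT p) sX). Qed.

Lemma cov_end_skew J p V W u : smooth_endo J -> skew g J ->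
  smooth_field V p -> smooth_field W p ->
  ip (g p) (cov_end D J V p u) (W p) = - ip (g p) (V p) (cov_end D J W p u).
Proof.
move=> sJ kJ sV sW; rewrite /cov_end !ipE kJ.
have E1 := metric_compatible u (sJ _ _ sV) sW.
have E2 := metric_compatible u sV (smooth_fieldN HM (sJ _ _ sW)).
have E : (fun q => ip (g q) (J q (V q)) (W q) : R^o) =
         (fun q => ip (g q) (V q) (- J q (W q)) : R^o).
  by apply/funext => q; rewrite kJ ipNr.
move: E1; rewrite E E2 (connN HM Hconn) ?ipE ?kJ; last exact: sJ.
by lra.
Qed.

(** By [cov_end_skew], pairing with a test field moves the derivative off [V], of which only the
    value at [p] remains; nondegeneracy concludes without a local frame. *)
Lemma cov_end_tensor J p V V' u : smooth_endo J -> skew g J ->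
  smooth_field V p -> smooth_field V' p -> V p = V' p ->
  cov_end D J V p u = cov_end D J V' p u.
Proof.
move=> sJ kJ sV sV' E; apply: (ip_inj (gU p)) => w.
have sW := smooth_extension HM p w.
rewrite -{1 2}(extension_self HM p w).
by rewrite (cov_end_skew u sJ kJ sV sW) (cov_end_skew u sJ kJ sV' sW) E.
Qed.

Lemma cov_end_compose J K L p V u : (forall q v, L q v = J q (K q v)) ->
  cov_end D L V p u = cov_end D J (fun q => K q (V q)) p u + J p (cov_end D K V p u).
Proof.
move=> E; rewrite /cov_end linearB /= E.
have -> : (fun q => L q (V q)) = (fun q => J q (K q (V q))) by apply/funext => q.
by rewrite addrA subrK.
Qed.

(* For skew [J] the choice of the extension of [x] is irrelevant, see [cov_endE]. *)
Definition cov_at J p (u x : 'rV[R]_m) := cov_end D J (extension p x) p u.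

Lemma cov_endE J p V u : smooth_endo J -> skew g J -> smooth_field V p ->
  cov_end D J V p u = cov_at J p u (V p).
Proof.
move=> sJ kJ sV; apply: (cov_end_tensor u sJ kJ sV (smooth_extension HM _ _)).
by rewrite (extension_self HM).
Qed.

Lemma cov_at_skew J p u x y : smooth_endo J -> skew g J ->
  ip (g p) (cov_at J p u x) y = - ip (g p) x (cov_at J p u y).
Proof.
move=> sJ kJ; have sE w := smooth_extension HM p w.
by have := cov_end_skew u sJ kJ (sE x) (sE y); rewrite !(extension_self HM).
Qed.

Lemma cov_at_linear J p a u x y : smooth_endo J -> skew g J ->
  cov_at J p u (a *: x + y) = a *: cov_at J p u x + cov_at J p u y.
Proof.
move=> sJ kJ; apply: (ip_inj (gU p)) => w.
have E z : ip (g p) (cov_at J p u z) w = - ip (g p) z (cov_at J p u w).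
  exact: cov_at_skew.
move: (E x) (E y) (E (a *: x + y)).
move: (cov_at J p u (a *: x + y)) (cov_at J p u x) (cov_at J p u y) => C A B EA EB EC.
by rewrite EC !ipDl !ipZl EA EB; ring.
Qed.

Lemma cov_at_linearl J p a u v x :
  cov_at J p (a *: u + v) x = a *: cov_at J p u x + cov_at J p v x.
Proof.
rewrite /cov_at /cov_end !(linearD, linearZ) /=.
by apply/rowP => i; rewrite !mxE; ring.
Qed.

Lemma cov_at0r J p u : smooth_endo J -> skew g J -> cov_at J p u 0 = 0.
Proof.
move=> sJ kJ; have := cov_at_linear p (-1) u 0 0 sJ kJ.
by rewrite scaler0 addr0 scaleN1r addNr.
Qed.

Lemma cov_at0l J p x : cov_at J p 0 x = 0.
Proof. by have := cov_at_linearl J p (-1) 0 0 x; rewrite scaler0 addr0 scaleN1r addNr. Qed.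

Lemma cov_at_compose J K L p u x : (forall q v, L q v = J q (K q v)) ->
  smooth_endo J -> skew g J -> smooth_endo K ->
  cov_at L p u x = cov_at J p u (K p x) + J p (cov_at K p u x).
Proof.
move=> E sJ kJ sK; have sX := smooth_extension HM p x.
rewrite {1}/cov_at (cov_end_compose _ _ _ E) (cov_endE _ sJ kJ (sK _ _ sX)).
by rewrite (extension_self HM).
Qed.

Lemma cov_at_involution J p u x : (forall q v, J q (J q v) = v) ->
  smooth_endo J -> skew g J -> cov_at J p u (J p x) = - J p (cov_at J p u x).
Proof.
move=> JJ sJ kJ; have sX := smooth_extension HM p x.
have := @cov_at_compose J J (fun=> \1%VF) p u x _ sJ kJ sJ.
rewrite {1}/cov_at /cov_end.
have -> : (fun q => (\1%VF : 'End('rV[R]_m)) (extension p x q)) = extension p x.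
  by apply/funext => q; rewrite id_lfunE.
rewrite id_lfunE subrr => E.
by apply/eqP; rewrite -addr_eq0 -E // => q v; rewrite id_lfunE JJ.
Qed.

Lemma parallelP J : smooth_endo J -> skew g J ->
  parallel D J <-> forall p u x, cov_at J p u x = 0.
Proof.
move=> sJ kJ; split=> [pJ p u x|S0 p V sV u]; first exact: pJ (smooth_extension HM p x) u.
by rewrite cov_endE.
Qed.

End LeviCivita.

(** * The connection of the cone in terms of that of M *)

Section ConeConnection.
Variables (R : realType) (m : nat) (M : charted R m).
Variables (g : M -> 'M[R]_m) (D : vfield M -> endfield M)
  (hD : vfield (cone M) -> endfield (cone M)).
Hypotheses (HM : C1_atlas M) (Hg : pseudo_riemannian g)
  (HD : levi_civita g D) (HhD : levi_civita (cone_metric g) hD).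
Implicit Types (z : cone M) (a b : R) (v w : 'rV[R]_m) (X Y T : vfield M).

Let HC := cone_C1_atlas HM.
Let gT p : (g p)^T = g p. Proof. by case: Hg. Qed.
Let gU p : g p \in unitmx. Proof. by case: Hg. Qed.
Let Hconn : is_connection D. Proof. by case: HD. Qed.
Let Hhconn : is_connection hD. Proof. by case: HhD. Qed.

Lemma smooth_ip p X Y : smooth_field X p -> smooth_field Y p ->
  smooth_fun (fun q => ip (g q) (X q) (Y q)) p.
Proof. by case: Hg => _ _; apply. Qed.

Lemma cone_metric_sym z : (cone_metric g z)^T = cone_metric g z.
Proof. by rewrite /cone_metric tr_block_mx !trmx0 trmx1 linearZ /= gT. Qed.

Lemma cone_metric_unit z : cone_metric g z \in unitmx.
Proof.
rewrite unitmxE /cone_metric det_lblock det1 mul1r detZ unitrM -unitmxE gU andbT.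
by rewrite unitrX // unitrX // unitfE gt_eqF // radius_gt0.
Qed.

(* The difference of both sides, paired with a third field, is symmetric in two
   of the three fields and skew in two others, as in [braid_eq0]. *)
Lemma conn_cfield b Y z a v : smooth_field Y z.2 ->
  hD (cfield b Y) z (cvec a v) =
  cvec (- radius z * ip (g z.2) (Y z.2) v)
    (D Y z.2 v + (a / radius z) *: Y z.2 + (b / radius z) *: v).
Proof.
set r := radius z; set p := z.2 => sY.
have r0 : r != 0 by rewrite gt_eqF // radius_gt0.
pose F (i : R * vfield M) := cfield i.1 i.2 : vfield (cone M).
pose c (i j : R * vfield M) := cvec (- r * ip (g p) (j.2 p) (i.2 p))
  (D j.2 p (i.2 p) + (i.1 / r) *: j.2 p + (j.1 / r) *: i.2 p).
pose t i j k := ip (cone_metric g z) (hD (F j) z (F i z) - c i j) (F k z).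
pose P (i : R * vfield M) := smooth_field i.2 p.
have sF i : P i -> smooth_field (F i) z by move=> Pi; exact: smooth_cfield.
have t0 : forall i j k, P i -> P j -> P k -> t i j k = 0.
  apply: braid_eq0 => i j k Pi Pj Pk.
    rewrite /t; congr (ip _ _ _).
    have := torsion_free HhD (sF i Pi) (sF j Pj).
    rewrite (bracket_cfield HM _ _ Pi Pj) (torsion_free HD Pi Pj).
    move=> /esym/(canRL (subrK _)) ->.
    rewrite /c (ipC _ _ (gT p)) -addrA addrCA -[in RHS]addrA; congr (_ + _).
    rewrite !cvecN !cvecD; congr cvec; first by ring.
    by apply/rowP => l; rewrite !mxE; ring.
  have := metric_compatible HhD (F i z) (sF j Pj) (sF k Pk).
  have -> : (fun z' => ip (cone_metric g z') (F j z') (F k z') : R^o) =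
     (fun z' => j.1 * k.1 + radius z' ^+ 2 * ip (g z'.2) (j.2 z'.2) (k.2 z'.2) : R^o).
    by apply/funext => z'; rewrite ip_cone.
  have Ed := dir_warped HM (j.1 * k.1) i.1 (i.2 p) (smooth_ip Pj Pk).
  move=> E; have {E} := etrans (esym Ed) E.
  rewrite (metric_compatible HD _ Pj Pk) -/r -/p => E.
  pose C x y := ipC x y (gT p).
  have tE j' k' : t i j' k' = ip (cone_metric g z) (hD (F j') z (F i z)) (F k' z) -
      ip (cone_metric g z) (c i j') (F k' z) by rewrite /t ipDl ipNl.
  have cE j' k' : ip (cone_metric g z) (c i j') (F k' z) =
    - r * ip (g p) (j'.2 p) (i.2 p) * k'.1 + r ^+ 2 *
      (ip (g p) (D j'.2 p (i.2 p)) (k'.2 p) + i.1 / r * ip (g p) (j'.2 p) (k'.2 p) +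
      j'.1 / r * ip (g p) (i.2 p) (k'.2 p)).
    by rewrite [F k' z]/(cvec k'.1 (k'.2 p)) ip_cone -/p -/r !ipE.
  rewrite !tE !cE [ip _ (hD (F k) z _) _](ipC _ _ (cone_metric_sym z)).
  move/esym/(canRL (addrK _)): E => ->.
  rewrite (C (i.2 p) (k.2 p)) (C (i.2 p) (j.2 p)) (C (k.2 p) (j.2 p)).
  rewrite (C _ (j.2 p)).
  by field.
apply: (ip_inj (cone_metric_unit z)) => w; rewrite [w]cvecP.
have := t0 (a, extension p v) (b, Y) (lsubmx w 0 0, extension p (rsubmx w))
  (smooth_extension HM p v) sY (smooth_extension HM p _).
rewrite /t ipDl ipNl => /eqP; rewrite subr_eq0 => /eqP.
by rewrite /F /c /cfield /= -/p !(extension_self HM).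
Qed.

Lemma smooth_lift T z : smooth_field T z.2 -> smooth_field (cone_lift T) z.
Proof. by rewrite cone_liftE; exact: smooth_cfield. Qed.

Lemma smooth_vlift T : smooth_vfield T -> smooth_vfield (cone_lift T).
Proof. by move=> sT z; exact: smooth_lift. Qed.

Lemma conn_lift T z a v : smooth_field T z.2 ->
  hD (cone_lift T) z (cvec a v) =
  cvec (- radius z * ip (g z.2) (T z.2) v) (D T z.2 v + (a / radius z) *: T z.2).
Proof. by move=> sT; rewrite cone_liftE (conn_cfield _ _ _ sT) mul0r scale0r addr0. Qed.

(** Leibniz rule for r times d/dr: the derivative of r contributes the radial part of [u], and
    nabla^_v (d/dr) = v / r the part tangent to M. *)
Lemma conn_radial z u : hD (@radial R m M) z u = u.
Proof.
have sX := smooth_field0 HM z.2.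
have r0 : radius z != 0 by rewrite gt_eqF // radius_gt0.
have -> : @radial R m M = (fun z => radius z *: cfield 1 (fun=> 0 : 'rV[R]_m) z) :> vfield (cone M).
  by apply/funext => z'; rewrite /radial /cfield cvecZ mulr1 scaler0.
rewrite (connZ Hhconn _ (smooth_radius HM z)); last exact: smooth_cfield.
rewrite [u]cvecP (dir_radius HM) (conn_cfield _ _ _ sX) /= /cfield !cvecZ cvecD ip0l.
rewrite (conn0 HM Hconn) zero_lfunE !scaler0 !add0r !mulr0 mulr1 addr0 scalerA.
by congr cvec; rewrite mulrCA mulfV // mulr1 scale1r.
Qed.

(** * The endomorphism field nabla^ T of a lifted field *)

Section Lift.
Variable T : vfield M.
Hypotheses (sT : smooth_vfield T) (kT : skew g (D T)).

Let J := hD (cone_lift T).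

Lemma lift_radial z : J z (radial z) = cone_lift T z.
Proof.
have r0 : radius z != 0 by rewrite gt_eqF // radius_gt0.
rewrite /J /radial (conn_lift _ _ (sT _)) ip0r mulr0 linear0 add0r mulfV // scale1r.
by rewrite cone_liftE.
Qed.

(** On a d/dr + v and b d/dr + w the mixed terms r (a g(T, w) - b g(T, v)) are skew by themselves;
    the rest is r^2 times the form of [D T]. *)
Lemma skew_lift : skew (cone_metric g) J.
Proof.
move=> z u w; rewrite [u]cvecP [w]cvecP /J !(conn_lift _ _ (sT _)) !ip_cone !ipE kT.
rewrite (ipC _ (T z.2) (gT z.2)).
have r0 : radius z != 0 by rewrite gt_eqF // radius_gt0.
by field.
Qed.

Lemma smooth_endo_lift : smooth_endo J.
Proof. by apply: (smooth_endo_conn HhD); exact: smooth_vlift. Qed.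

(* On [cone M], [J] applied to the lift of [X] is [- g(X, T) radial + phi X]
   with [phi = nabla T], and [J radial = T]. *)
Lemma cov_end_lift X z u : smooth_field X z.2 ->
  cov_end hD J (cone_lift X) z u =
  cvec 0 (cov_end D (D T) X z.2 (rsubmx u) - ip (g z.2) (X z.2) (T z.2) *: rsubmx u
          + ip (g z.2) (X z.2) (rsubmx u) *: T z.2).
Proof.
move=> sX; rewrite [u in LHS]cvecP; set a := lsubmx u 0 0; set v := rsubmx u.
have r0 : radius z != 0 by rewrite gt_eqF // radius_gt0.
have sf : smooth_fun (fun q => - ip (g q) (X q) (T q) : R^o) z.2.
  have -> : (fun q => - ip (g q) (X q) (T q) : R^o) = (fun q => ip (g q) (X q) (- T q)).
    by apply/funext => q; rewrite ipNr.
  exact: smooth_ip sX (smooth_fieldN HM (sT _)).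
have sP := conn_smooth Hconn (sT z.2) sX.
have JE : (fun z' => J z' (cone_lift X z')) = (fun z' : cone M =>
    (- ip (g z'.2) (X z'.2) (T z'.2)) *: radial z' +
    cone_lift (fun q => D T q (X q)) z').
  apply/funext => z'; rewrite !cone_liftE /J /cfield /radial cvecZ cvecD.
  rewrite (conn_lift _ _ (sT _)) mul0r scale0r scaler0 addr0 add0r addr0.
  by rewrite (ipC _ _ (gT _)); congr cvec; ring.
have df : dir (fun q => - ip (g q) (X q) (T q) : R^o) z.2 v =
    - ip (g z.2) (D X z.2 v) (T z.2) - ip (g z.2) (X z.2) (D T z.2 v).
  have -> : (fun q => - ip (g q) (X q) (T q) : R^o) = (fun q => ip (g q) (X q) (- T q)).
    by apply/funext => q; rewrite ipNr.
  rewrite (metric_compatible HD _ sX (smooth_fieldN HM (sT _))).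
  by rewrite (connN HM Hconn _ (sT _)) !ipE; ring.
have sR := smooth_radial HM z; have sf' := smooth_fun_cone sf.
rewrite /cov_end JE (connD Hhconn _ (smooth_fieldZ HC sf' sR) (smooth_lift sP)).
rewrite (connZ Hhconn _ sf' sR).
rewrite (dir_cone _ _ sf) df conn_radial /radial (conn_lift _ _ sP) (conn_lift _ _ sX).
rewrite /J (conn_lift _ _ (sT _)) !cvecZ !cvecD cvecN cvecD; congr cvec.
  rewrite ipDr ipZr kT (ipC (D X _ _) _ (gT _)) (ipC (X _) (T _) (gT _)).
  by field.
rewrite [D T _ (_ + _)]linearD linearZ /=.
by apply/rowP => l; rewrite !mxE; field.
Qed.

(** Since [J] sends [radial] to the lift of [T] and nabla^ [radial] is the identity, both terms of
    the derivative equal [J z u]. *)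
Lemma cov_end_radial z u : cov_end hD J (@radial R m M) z u = 0.
Proof.
rewrite /cov_end conn_radial.
have -> : (fun z' => J z' (radial z')) = cone_lift T by apply/funext => z'; exact: lift_radial.
by rewrite subrr.
Qed.

Lemma cov_end_cone V X z u : smooth_field V z -> smooth_field X z.2 ->
  rsubmx (V z) = X z.2 ->
  cov_end hD J V z u =
  cvec 0 (cov_end D (D T) X z.2 (rsubmx u) - ip (g z.2) (X z.2) (T z.2) *: rsubmx u
          + ip (g z.2) (X z.2) (rsubmx u) *: T z.2).
Proof.
move=> sV sX VX; rewrite -cov_end_lift //.
(* By tensoriality [V] may be replaced by [c] times [radial] plus the lift of [X]; this constant
   makes the two agree at [z]. *)
pose c := lsubmx (V z) 0 0 / radius z.
have r0 : radius z != 0 by rewrite gt_eqF // radius_gt0.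
have sR := smooth_fieldZc HC c (smooth_radial HM z); have sL := smooth_lift sX.
rewrite (@cov_end_tensor _ _ _ _ _ HC cone_metric_unit HhD J z V
  (fun z' => c *: radial z' + cone_lift X z') u smooth_endo_lift skew_lift sV
  (smooth_fieldD HC sR sL)).
- have sJ := smooth_endo_lift.
  transitivity (c *: cov_end hD J (@radial R m M) z u + cov_end hD J (cone_lift X) z u).
    rewrite /cov_end (connD Hhconn _ sR sL) (connZc HC Hhconn _ _ (smooth_radial HM z)).
    have -> : (fun q => J q (c *: radial q + cone_lift X q)) =
       (fun q => c *: J q (radial q) + J q (cone_lift X q)).
      by apply/funext => q; rewrite linearD linearZ.
    rewrite (connD Hhconn); last 2 first.
    + exact/(smooth_fieldZc HC)/sJ/smooth_radial.
    + exact: sJ.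
    rewrite (connZc HC Hhconn); last exact/sJ/smooth_radial.
    by rewrite linearD linearZ /= scalerBr opprD addrACA.
  by rewrite cov_end_radial scaler0 add0r.
- rewrite [V z]cvecP VX cone_liftE /cfield /radial cvecZ cvecD scaler0 add0r addr0.
  by rewrite /c divfK.
Qed.

End Lift.
End ConeConnection.

(** * Parallel structures on the cone are lifts *)

Lemma derive0_eq (R : realType) (f : R -> R) (s t : R) : 0 < s -> 0 < t ->
  (forall x : R, 0 < x -> is_derive x 1 f 0) -> f s = f t.
Proof.
move=> s0 t0 df; wlog st : s t s0 t0 / s <= t.
  by move=> H; case: (leP s t) => [|/ltW] st; [|apply/esym]; apply: H.
have [||c cst] := @MVT_segment R f (fun=> 0) s t st.
- by move=> x; rewrite in_itv /= => /andP[sx _]; apply/df/(lt_trans s0).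
- apply: continuous_in_subspaceT => x; rewrite inE /= in_itv /= => /andP[sx _].
  apply/differentiable_continuous/derivable1_diffP.
  by have [] := df x (lt_le_trans s0 sx).
- by rewrite mul0r => /eqP; rewrite subr_eq0 => /eqP ->.
Qed.

Section Radial.
Variables (R : realType) (m : nat) (M : charted R m).
Variables (g : M -> 'M[R]_m) (D : vfield M -> endfield M)
  (hD : vfield (cone M) -> endfield (cone M)).
Hypotheses (HM : C1_atlas M) (Hg : pseudo_riemannian g)
  (HD : levi_civita g D) (HhD : levi_civita (cone_metric g) hD).
Variable J : endfield (cone M).
Hypotheses (sJ : smooth_endo J) (kJ : skew (cone_metric g) J) (pJ : parallel hD J).

Let HC := cone_C1_atlas HM.

Let Z : vfield (cone M) := fun z => J z (radial z).

(** The field [Z] will turn out to be independent of the radius; it is read off at radius 1, where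
    [radial] is d/dr. *)
Definition unlift : vfield M := fun p =>
  rsubmx (J (half_line1 R, p) (cvec 1 0)).

Let sZ z : smooth_field Z z.
Proof. by apply: sJ; exact: smooth_radial. Qed.

Let hZ z u : hD Z z u = J z u.
Proof.
have := pJ (smooth_radial HM z) u; rewrite /cov_end (conn_radial HM Hg HD HhD).
by move/eqP; rewrite subr_eq0 => /eqP.
Qed.

Let Z_tangent z : Z z = cvec 0 (rsubmx (Z z)).
Proof.
have r0 : radius z != 0 by rewrite gt_eqF // radius_gt0.
have := kJ z (radial z) (radial z).
rewrite (ipC (radial z) _ (cone_metric_sym Hg z)) -/(Z z).
rewrite {1 2}[Z z]cvecP /radial !ip_cone !ip0r !mulr0 !addr0 => E.
rewrite [LHS]cvecP; suff -> : lsubmx (Z z) 0 0 = 0 by [].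
have : lsubmx (Z z) 0 0 * radius z = 0 by lra.
by move=> /eqP; rewrite mulf_eq0 (negPf r0) orbF => /eqP.
Qed.

Let Z_radial z : Z z = radius z *: J z (cvec 1 0).
Proof. by rewrite /Z /radial -linearZ /= cvecZ mulr1 scaler0. Qed.

(** The components of d/dr are constant, so this derivative is [d/dr, Z] = J (d/dr) - nabla^_Z
    (d/dr). The last term is Z / r, which equals J (d/dr) because Z = r J (d/dr). *)
Let derive_Z z :
  'D_(cvec 1 0) (components (chart_at z) Z) (coord (chart_at z) z) = 0.
Proof.
have r0 : radius z != 0 by rewrite gt_eqF // radius_gt0.
have s0 := smooth_field0 HM z.2.
have sR : smooth_field (cfield 1 (fun=> 0 : 'rV[R]_m) : vfield (cone M)) z.
  exact: smooth_cfield.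
have E := derive_components_cfield HM 1 (Z z) s0.
have := etrans (esym (congr1 (fun x => _ - x) E)) (torsion_free HhD sR (sZ z)).
rewrite hZ [in X in _ = _ - X]Z_tangent (conn_cfield HM Hg HD HhD _ _ _ s0).
have -> : components (chart_at z.2) (fun=> 0 : 'rV[R]_m) = cst 0.
  by apply/funext => x; rewrite /components /dir derive0.
rewrite derive_cst cvec0 subr0 [cfield _ _ z]/(cvec 1 0) => ->.
rewrite ip0l !mulr0 scaler0 addr0.
have Hconn : is_connection D by case: HD.
rewrite (conn0 HM Hconn) zero_lfunE add0r.
apply/eqP; rewrite subr_eq0; apply/eqP.
apply: (scalerI r0); rewrite -Z_radial cvecZ mulr0 scalerA mulrCA mul1r mulfV //.
by rewrite scale1r -Z_tangent.
Qed.

Let Z_constant (p : M) (s t : half_line R) : Z (s, p) = Z (t, p) :> 'rV[R]_(1 + m).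
Proof.
pose k : 'rV[R]_m := coord (chart_at p) p.
(* The preferred chart at [(s, p)] does not depend on [s], so a single chart serves the whole ray
   over [p]. *)
pose F : 'rV[R]_(1 + m) -> 'rV[R]_(1 + m) :=
  components (chart_at ((half_line1 R, p) : cone M)) Z.
have FE (s' : half_line R) : F (val s' *: cvec 1 0 + cvec 0 k) = Z (s', p).
  rewrite cvecZ cvecD mulr1 scaler0 addr0 add0r -[RHS](components_self HC).
  by rewrite coordE.
have dF (x : R) : 0 < x -> derivable (fun y : R => F (y *: cvec 1 0 + cvec 0 k)) x 1 /\
    'D_1 (fun y : R => F (y *: cvec 1 0 + cvec 0 k)) x = 0.
  move=> x0; have [dP dE] := derive_line F (cvec 1 0) (cvec 0 k) x.
  pose z : cone M := (insubd (half_line1 R) x, p).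
  have zE : x *: cvec 1 0 + cvec 0 k = coord (chart_at z) z.
    by rewrite coordE cvecZ cvecD mulr1 scaler0 addr0 add0r /radius val_half_line.
  split; last by rewrite dE zE; exact: derive_Z.
  by apply/dP; rewrite zE; apply: diff_derivable; exact: (smooth_field_diff (sZ z)).
apply/rowP => j; rewrite -!FE.
apply: (@derive0_eq _ (fun x => F (x *: cvec 1 0 + cvec 0 k) 0 j));
  [exact: half_line_gt0|exact: half_line_gt0|].
move=> x /dF[dx Ex]; have dxj := (derivable_mxP _ _ _).1 dx 0 j.
apply: DeriveDef; first exact: dxj.
by move: Ex; rewrite (derive_mx dx) => /matrixP/(_ 0 j); rewrite !mxE.
Qed.

Lemma smooth_unlift : smooth_vfield unlift.
Proof.
move=> p; pose z : cone M := (half_line1 R, p).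
have [U [oU Ui Uz] sU] := sZ z.
(* The slice of radius 1: along it the components of [Z] are those of [unlift], which inherits its
   smoothness from [Z]. *)
pose L (y : 'rV[R]_m) : 'rV[R]_(1 + m) := cvec 1 y.
have cL : continuous L.
  move=> y; apply: differentiable_continuous.
  have -> : L = cst (inlx m (1%:M : 'rV[R]_1)) + @inrx R 1 m.
    by apply/funext => x; rewrite /L /cvec row_mxE.
  apply: differentiableD; first exact: differentiable_cst.
  exact/linear_differentiable/linear_rV_continuous.
have LU y : U (L y) -> img (chart_at p) y.
  by move=> /Ui; rewrite img_cone => -[_]; rewrite /L /cvec /= row_mxKr.
exists (L @^-1` U) => [|k].
  split=> //; first by apply: open_comp => // x _; exact: cL.
  by move: Uz; rewrite coordE.
pose s (i : 'I_m) := Some (rshift 1 i).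
have Ls h i y : L (h *: delta_mx 0 i + y) = h *: oapp (delta_mx 0) 0 (s i) + L y.
  rewrite /= delta_rshift /L.
  by rewrite -cvec0l cvecZ cvecD mulr0 add0r.
have oL : open (L @^-1` U) by apply: open_comp => // x _; exact: cL.
apply: Ck_eq oL _ (Ck_lin (L := rsubmx) oL (@continuous_rsubmx _ _ _ _)
  (Ck_reindex cL Ls oU (sU k))) => y Uy.
have iLy : img (chart_at z) (L y) by exact: Ui.
rewrite -[LHS]/(rsubmx (components (chart_at z) Z (L y))).
rewrite (components_cone HM _ iLy) row_mxKr.
have -> : rsubmx (L y) = y by rewrite /L /cvec row_mxKr.
apply: (congr1 (fun X => components (chart_at p) X y)); apply/funext => q.
by rewrite (Z_constant q _ (half_line1 R)).
Qed.

Lemma unlift_lift : hD (cone_lift unlift) = J.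
Proof.
have -> : cone_lift unlift = Z.
  apply/funext => z; rewrite [RHS]Z_tangent cone_liftE; congr cvec.
  case: z => s p; rewrite (Z_constant p s (half_line1 R)).
  by [].
by apply/funext => z; apply/lfunP => u; exact: hZ.
Qed.

End Radial.

(** * Linear algebra of para-complex structures *)

Section Spaces.
Variables (R : realType) (m : nat).
Implicit Types (h : 'M[R]_m) (u v w : 'rV[R]_m) (W : {vspace 'rV[R]_m})
  (J K : 'End('rV[R]_m)).

Lemma half_addB v w : v = 2^-1 *: ((v + w) + (v - w)).
Proof. by apply/rowP => i; rewrite !mxE; field. Qed.

Lemma mem_lker_ip h u v :
  (v \in lker (linfun (mulmxr (h *m u^T)))) = (ip h v u == 0).
Proof.
rewrite memv_ker lfunE /= mulmxA /ip; apply/eqP/eqP => [->|E]; first by rewrite mxE.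
by apply/matrixP => i j; rewrite !ord1 E mxE.
Qed.

Lemma mem_orth1 h u v : (v \in orth h [:: u]) = (ip h v u == 0).
Proof. by rewrite /orth big_cons big_nil capvf mem_lker_ip. Qed.

Lemma mem_orth3 h u1 u2 u3 v : (v \in orth h [:: u1; u2; u3]) =
  [&& ip h v u1 == 0, ip h v u2 == 0 & ip h v u3 == 0].
Proof. by rewrite /orth !big_cons big_nil capvf !memv_cap !mem_lker_ip. Qed.

Lemma eigen_plusP J v : reflect (J v = v) (v \in eigen_plus J).
Proof.
rewrite memv_ker !lfunE /= id_lfunE lfunE /= subr_eq0 eq_sym.
exact: eqP.
Qed.

Lemma eigen_minusP J v : reflect (J v = - v) (v \in eigen_minus J).
Proof.
rewrite memv_ker !lfunE /= id_lfunE addrC addr_eq0.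
exact: eqP.
Qed.

Lemma dimv_le_inj W W' K : (forall v, v \in W -> K v \in W') ->
  (forall v, v \in W -> K v = 0 -> v = 0) -> (\dim W <= \dim W')%N.
Proof.
move=> KW Kinj.
have W0 : (W :&: lker K = 0)%VS.
  apply/eqP; rewrite -subv0; apply/subvP => v; rewrite memv_cap memv_ker memv0.
  by move=> /andP[vW /eqP Kv]; apply/eqP/Kinj.
rewrite -(limg_dim_eq W0); apply: dimvS; apply/subvP => _ /memv_imgP[v vW ->].
exact: KW.
Qed.

(* An endomorphism anticommuting with [J] exchanges the eigenspaces of [J]. *)
Lemma para_complex_swap W J K : (forall v, v \in W -> J v \in W) ->
  (forall v, v \in W -> J (J v) = v) -> (forall v, v \in W -> K v \in W) ->
  (forall v, v \in W -> K v = 0 -> v = 0) ->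
  (forall v, v \in W -> K (J v) = - J (K v)) -> para_complex W J.
Proof.
move=> JW JJ KW Kinj KJ; split=> //.
  by apply/subvP => _ /memv_imgP[v vW ->]; exact: JW.
apply/eqP; rewrite eqn_leq; apply/andP; split; apply: (@dimv_le_inj _ _ K) => v;
  rewrite !memv_cap => /andP[vW Jv].
- rewrite KW //=; apply/eigen_minusP; move/eigen_plusP: Jv => Jv.
  by have := KJ v vW; rewrite Jv => E; rewrite [in RHS]E opprK.
- exact: Kinj.
- rewrite KW //=; apply/eigen_plusP; move/eigen_minusP: Jv => Jv.
  by have := KJ v vW; rewrite Jv linearN => /oppr_inj.
- exact: Kinj.
Qed.

(* The covariant derivative [S] of [J] is symmetric and alternating on the part
   of an eigenspace of [J] orthogonal to [e]; [J'], which exchanges the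
   eigenspaces, carries its vanishing to the other one. *)
Lemma integrable_vanish h J J' (S : 'rV[R]_m -> 'rV[R]_m -> 'rV[R]_m) e :
  h \in unitmx -> h^T = h ->
  (forall u v, ip h (J u) v = - ip h u (J v)) ->
  (forall v, J (J v) = v) -> (forall v, J' (J v) = - J (J' v)) ->
  (forall v, J' v = 0 -> v = 0) ->
  (forall a u v w, S u (a *: v + w) = a *: S u v + S u w) ->
  (forall u v w, ip h (S u v) w = - ip h v (S u w)) ->
  (forall u v, S u (J v) = - J (S u v)) ->
  (forall u v, S u (J' v) = - J' (S u v)) ->
  ip h e e = 1 -> (forall u, S u e = 0) ->
  (forall A B, J A = A -> J B = B -> ip h A e = 0 -> ip h B e = 0 ->
     S A B = S B A) ->
  forall A, J A = A -> ip h A e = 0 -> forall v, S A v = 0.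
Proof.
move=> hU hT kJ JJ J'J J'inj Slin kS SJ SJ' ee Se sym A JA Ae.
have S0 u : S u 0 = 0 by have := Slin (-1) u 0 0; rewrite scaler0 addr0 scaleN1r addNr.
have SD u v w : S u (v + w) = S u v + S u w by have := Slin 1 u v w; rewrite !scale1r.
have SZ a u v : S u (a *: v) = a *: S u v by have := Slin a u v 0; rewrite S0 !addr0.
have SJe u : S u (J e) = 0 by rewrite SJ Se linear0 oppr0.
have Jee : ip h (J e) e = 0.
  by have := kJ e e; rewrite (ipC e (J e) hT) => ?; lra.
pose W v := J v = v /\ ip h v e = 0.
(* As [J e] is orthogonal to [e], subtracting a multiple of the eigenvector [e + J e] makes [v]
   orthogonal to [e]; [S u] does not see the correction. *)
have dec v : J v = v -> W (v - ip h v e *: (e + J e)).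
  move=> Jv; split; first by rewrite linearB linearZ linearD /= JJ Jv (addrC e).
  by rewrite !ipE ee Jee; ring.
have t0 : forall x y z, W x -> W y -> W z -> ip h (S x y) z = 0.
  apply: braid_eq0 => x y z [Jx xe] [Jy ye] [Jz ze]; first by rewrite (sym x y).
  by rewrite kS (ipC y) // .
have plus0 v : J v = v -> ip h (S A v) e = 0 /\ ip h (S A v) (J e) = 0.
  by move=> Jv; rewrite !kS Se SJe !ip0r oppr0.
have SWW B : W B -> S A B = 0.
  move=> WB; apply: (ip_eq0 hU) => X.
  pose Xp := X + J X; pose Xm := X - J X.
  have JXp : J Xp = Xp by rewrite /Xp linearD /= JJ addrC.
  have JXm : J Xm = - Xm by rewrite /Xm linearB /= JJ opprB.
  have -> : X = 2^-1 *: (Xp + Xm).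
    exact: half_addB.
  have p0 : ip h (S A B) Xp = 0.
    have := t0 A B _ (conj JA Ae) WB (dec _ JXp).
    have [] := plus0 B WB.1; rewrite !ipE => -> ->; lra.
  (* [S A] anticommutes with [J], so [S A B] lies in the eigenspace for -1, which is isotropic
     because [J] is skew. *)
  have m0 : ip h (S A B) Xm = 0.
    have JS : J (S A B) = - S A B by rewrite -{2}WB.1 SJ opprK.
    by have := kJ (S A B) Xm; rewrite JXm JS !ipE => ?; lra.
  by rewrite ipZr ipDr p0 m0 addr0 mulr0.
have SWp B : J B = B -> S A B = 0.
  move=> JB; rewrite -[B](subrK (ip h B e *: (e + J e))) SD (SWW _ (dec _ JB)).
  by rewrite SZ SD Se SJe addr0 scaler0 addr0.
move=> v.
have -> : v = 2^-1 *: ((v + J v) + (v - J v)).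
  exact: half_addB.
rewrite SZ SD SWp ?add0r; last by rewrite linearD /= JJ addrC.
rewrite (J'inj (S A (v - J v))) ?scaler0 //.
apply: oppr_inj; rewrite -SJ' oppr0; apply: SWp.
by rewrite -[LHS]opprK -J'J linearB /= JJ -linearN opprB.
Qed.

(** The previous lemma for [J] and for [-J] treats [A] in either eigenspace. A vector orthogonal to
    [e] and [J e] is the half sum of [A + J A] and [A - J A], both still orthogonal to [e]. *)
Lemma integrable_vanish2 h J J' (S : 'rV[R]_m -> 'rV[R]_m -> 'rV[R]_m) e :
  h \in unitmx -> h^T = h ->
  (forall u v, ip h (J u) v = - ip h u (J v)) ->
  (forall v, J (J v) = v) -> (forall v, J' (J v) = - J (J' v)) ->
  (forall v, J' v = 0 -> v = 0) ->
  (forall a u v w, S u (a *: v + w) = a *: S u v + S u w) ->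
  (forall a u v w, S (a *: u + v) w = a *: S u w + S v w) ->
  (forall u v w, ip h (S u v) w = - ip h v (S u w)) ->
  (forall u v, S u (J v) = - J (S u v)) ->
  (forall u v, S u (J' v) = - J' (S u v)) ->
  ip h e e = 1 -> (forall u, S u e = 0) ->
  (forall c A B, c = 1 \/ c = -1 -> J A = c *: A -> J B = c *: B ->
     ip h A e = 0 -> ip h B e = 0 -> S A B = S B A) ->
  forall A, ip h A e = 0 -> ip h A (J e) = 0 -> forall v, S A v = 0.
Proof.
move=> hU hT kJ JJ J'J J'inj Slin Slin' kS SJ SJ' ee Se sym A Ae AJe v.
have half c : c = 1 \/ c = -1 -> forall B, J B = c *: B -> ip h B e = 0 -> S B v = 0.
  move=> Hc B JB Be; have c1 : c * c = 1 by case: Hc => ->; rewrite ?mulr1 ?mulrNN ?mulr1.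
  have cJ w : (c *: J) w = c *: J w by rewrite lfunE.
  have eig w : (c *: J) w = w -> J w = c *: w.
    by rewrite cJ => E; rewrite -{2}E scalerA c1 scale1r.
  apply: (@integrable_vanish h (c *: J) J' S e) => //.
  - by move=> u w; rewrite !cJ ipZl ipZr kJ mulrN.
  - by move=> w; rewrite !cJ linearZ /= JJ scalerA c1 scale1r.
  - by move=> w; rewrite !cJ linearZ /= J'J scalerN.
  - move=> u w; rewrite !cJ; have := Slin c u (J w) 0.
    by rewrite SJ !addr0 => ->; have := Slin (-1) u 0 0;
       rewrite scaler0 addr0 scaleN1r addNr => ->; rewrite addr0 scalerN.
  - by move=> X Y /eig JX /eig JY; apply: (sym c).
  - by rewrite cJ JB scalerA c1 scale1r.
have SA : S A v = 2^-1 *: (S (A + J A) v + S (A - J A) v).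
  have S0 w : S 0 w = 0.
    by have := Slin' (-1) 0 0 w; rewrite scaler0 addr0 scaleN1r addNr.
  have := Slin' 2^-1 (A + J A + (A - J A)) 0 v; rewrite S0 !addr0 -half_addB => ->.
  by have := Slin' 1 (A + J A) (A - J A) v; rewrite !scale1r => ->.
have JAe : ip h (J A) e = 0 by rewrite kJ AJe oppr0.
rewrite SA (half 1) ?(half (-1)) ?addr0 ?scaler0 //; try by [left|right].
- by rewrite linearB /= JJ scaleN1r opprB.
- by rewrite ipDl ipNl Ae JAe subr0.
- by rewrite linearD /= JJ scale1r addrC.
- by rewrite ipDl Ae JAe addr0.
Qed.

End Spaces.

Lemma signature_of_gram (R : realType) (m k : nat) (h : 'M[R]_m)
    (P : 'M[R]_(1 + k + k, m)) : m = (1 + k + k)%N ->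
  P *m h *m P^T = block_mx (- 1%:M) 0 0 1%:M -> signature h k.+1 k.
Proof.
move=> mE; move: h P; rewrite mE => h P E; split=> //; exists P.
  apply: (proj1 (mulmx1_unit (B := h *m P^T *m block_mx (- 1%:M) 0 0 1%:M) _)).
  rewrite !mulmxA E mulmx_block !mulmx0 !mul0mx !addr0 add0r mulmxN mulNmx opprK.
  by rewrite !mulmx1 -scalar_mx_block.
rewrite E; apply/matrixP => i j; rewrite [RHS]mxE [X in X *+ _]mxE.
case: (split_ordP i) => i' -> ; case: (split_ordP j) => j' ->.
- by rewrite block_mxEul !mxE (inj_eq (@lshift_inj _ _)) mulNrn.
- by rewrite block_mxEur mxE eq_lrshift.
- by rewrite block_mxEdl mxE eq_rlshift.
- by rewrite block_mxEdr mxE (inj_eq (@rshift_inj _ _)).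
Qed.

(** * The signature forced by a skew para-complex structure on the orthogonal of [T] *)

Section Signature.
Variables (R : realType) (m : nat) (h J : 'M[R]_m) (T : 'rV[R]_m).
Hypotheses (hU : h \in unitmx) (hT : h^T = h) (kJ : J *m h = - (h *m J^T))
  (TT : T *m h *m T^T = (-1)%:M) (TJ : T *m J = 0)
  (JJ : forall v : 'rV[R]_m, v *m h *m T^T = 0 -> v *m J *m J = v).

(* The rows of [b] are the space-like vectors of a pseudo-orthonormal family
   whose time-like vectors are [T] and the images under [J] of the rows of [b]. *)
Let family k := exists b : 'M[R]_(k, m),
  [/\ b *m h *m b^T = 1%:M, b *m h *m (b *m J)^T = 0 & b *m h *m T^T = 0].

Let tr0 a c (x : 'M[R]_(a, m)) (y : 'M[R]_(c, m)) :
  x *m h *m y^T = 0 -> y *m h *m x^T = 0.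
Proof.
move=> /(congr1 trmx); rewrite trmx0 => <-.
by rewrite !trmx_mul trmxK hT mulmxA.
Qed.

Let skJ a c (x : 'M[R]_(a, m)) (y : 'M[R]_(c, m)) :
  (x *m J) *m h *m y^T = - (x *m h *m (y *m J)^T).
Proof.
by rewrite -(mulmxA x J h) kJ mulmxN mulNmx trmx_mul !mulmxA.
Qed.

Let JJm k (b : 'M[R]_(k, m)) : b *m h *m T^T = 0 -> b *m J *m J = b.
Proof.
move=> bT; apply/row_matrixP => i; rewrite !row_mul JJ // -!row_mul bT.
by rewrite row0.
Qed.

Let frame k (b : 'M[R]_(k, m)) : 'M[R]_(1 + k + k, m) := col_mx (col_mx T (b *m J)) b.

Let gram k : 'M[R]_(1 + k + k) := block_mx (- 1%:M) 0 0 1%:M.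

Let frame_gram k (b : 'M[R]_(k, m)) : b *m h *m b^T = 1%:M ->
  b *m h *m (b *m J)^T = 0 -> b *m h *m T^T = 0 ->
  frame b *m h *m (frame b)^T = gram k.
Proof.
move=> b1 bJ bT; have bJJ := JJm bT.
rewrite /frame !mul_col_mx !tr_col_mx !mul_mx_row.
have E : (b *m J) *m h *m T^T = 0 by rewrite skJ TJ trmx0 mulmx0 oppr0.
rewrite TT (tr0 E) E (tr0 bT) (tr0 bJ) bJ bT b1 skJ bJJ b1.
rewrite row_mx0 /gram; congr col_mx.
rewrite -[LHS]/(block_mx _ _ _ _) block_mxEh col_mx0; congr row_mx.
by rewrite -[LHS]/(block_mx _ _ _ _) -!raddfN -scalar_mx_block.
Qed.

Let gram2 k : gram k *m gram k = 1%:M.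
Proof.
rewrite /gram mulmx_block !mulmx0 !mul0mx !addr0 add0r mulmxN mulNmx opprK !mulmx1.
by rewrite -scalar_mx_block.
Qed.

Let frame_size k (b : 'M[R]_(k, m)) : frame b *m h *m (frame b)^T = gram k ->
  (1 + k + k <= m)%N.
Proof.
move=> E; have [/mxrank_unit rk _] := mulmx1_unit (gram2 k).
apply: (@leq_trans (\rank (gram k))); first by rewrite rk.
rewrite -E -mulmxA; apply: leq_trans (mxrankM_maxl _ _) _; exact: rank_leq_col.
Qed.

Let perpP k (b : 'M[R]_(k, m)) (v : 'rV[R]_m) : v *m h *m (frame b)^T = 0 <->
  [/\ v *m h *m T^T = 0, v *m h *m (b *m J)^T = 0 & v *m h *m b^T = 0].
Proof.
rewrite /frame !tr_col_mx !mul_mx_row; split=> [E|[-> -> ->]]; last by rewrite !row_mx0.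
by have := E; rewrite -row_mx0 => /eq_row_mx[]; rewrite -row_mx0 => /eq_row_mx[].
Qed.

(** The orthogonal of the frame is nonzero, nondegenerate and stable under [J], which reverses the
    sign of [h] on it. It thus contains a space-like vector [w]; normalised, [w] and its image under
    [J] enlarge the frame. *)
Let family_step k : family k -> (1 + k + k < m)%N -> family (1 + k).
Proof.
move=> [b [b1 bJ bT]] km.
have G := frame_gram b1 bJ bT.
set C := frame b in G; set A := h *m C^T.
have K0 : kermx A != 0.
  rewrite -mxrank_eq0 mxrank_ker -lt0n subn_gt0.
  exact: leq_ltn_trans (rank_leq_col _) km.
have /rowV0Pn[w0 /sub_kermxP w0A w00] := K0.
have w0C : w0 *m h *m C^T = 0 by rewrite -mulmxA.
have ipE' (x y : 'rV[R]_m) : ip h x y = 0 -> x *m h *m y^T = 0.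
  by move=> E; apply/matrixP => i j; rewrite !ord1 [LHS]E mxE.
have [u0 u0C w0u0] : exists2 u0, u0 *m h *m C^T = 0 & ip h w0 u0 != 0.
  have [u wu] : exists u, ip h w0 u != 0.
    apply: contrapT => /forallNP N; move/eqP: w00; apply; apply: (ip_eq0 hU) => v.
    by apply/eqP/negP => /negP; exact: N.
  (* Orthogonal projection away from the frame, whose Gram matrix is its own inverse; pairing with
     [w0] is unaffected. *)
  exists (u - u *m h *m C^T *m gram k *m C).
    rewrite !mulmxBl -(mulmxA _ C h) -(mulmxA _ (C *m h)) G.
    by rewrite -(mulmxA _ (gram k)) gram2 mulmx1 subrr.
  rewrite ipDr ipNr [X in _ - X]/ip trmx_mul mulmxA w0C mul0mx mxE subr0.
  exact: wu.
have perpD (x y : 'rV[R]_m) : x *m h *m C^T = 0 -> y *m h *m C^T = 0 ->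
    (x + y) *m h *m C^T = 0 by move=> E1 E2; rewrite !mulmxDl E1 E2 addr0.
have [x xC xx] : exists2 x, x *m h *m C^T = 0 & ip h x x != 0.
  have [Ew|] := eqVneq (ip h w0 w0) 0; last by exists w0.
  have [Eu|] := eqVneq (ip h u0 u0) 0; last by exists u0.
  (* Polarisation: if [w0] and [u0] are null, the square of their sum is twice their nonzero
     product. *)
  exists (w0 + u0); first exact: perpD.
  rewrite !ipDl !ipDr Ew Eu (ipC u0 _ hT) add0r addr0 -mulr2n -mulr_natl.
  by rewrite mulf_neq0 // pnatr_eq0.
have perpJ (y : 'rV[R]_m) : y *m h *m C^T = 0 -> (y *m J) *m h *m C^T = 0.
  move=> /perpP[yT yJ yb]; apply/perpP; split.
  - by rewrite skJ TJ trmx0 mulmx0 oppr0.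
  - by rewrite skJ (JJm bT) yb oppr0.
  - by rewrite skJ yJ oppr0.
have ipJ (y : 'rV[R]_m) : y *m h *m C^T = 0 -> ip h (y *m J) (y *m J) = - ip h y y.
  by move=> /perpP[yT _ _]; rewrite /ip skJ JJ // mxE.
have [y yC yy] : exists2 y, y *m h *m C^T = 0 & 0 < ip h y y.
  have [Ex|Ex|Ex] := ltgtP 0 (ip h x x); first by exists x.
    by exists (x *m J); [exact: perpJ|rewrite ipJ // oppr_gt0].
  by rewrite -Ex eqxx in xx.
pose w := (Num.sqrt (ip h y y))^-1 *: y.
have /perpP[wT wJ wb] : w *m h *m C^T = 0.
  by rewrite /w -!scalemxAl yC scaler0.
have ww : w *m h *m w^T = 1%:M.
  rewrite [LHS]mx11_scalar -[X in X%:M]/(ip h w w) /w ipZl ipZr mulrA -expr2.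
  by rewrite exprVn sqr_sqrtr ?ltW // mulVf // gt_eqF.
have wwJ : w *m h *m (w *m J)^T = 0.
  have E : ip h w (w *m J) = 0.
    have := congr1 (fun X : 'M[R]_1 => X 0 0) (skJ w w).
    by rewrite -[LHS]/(ip h (w *m J) w) (ipC _ _ hT) [RHS]mxE -/(ip h w (w *m J)); lra.
  exact: ipE'.
exists (col_mx w b); split.
- rewrite !mul_col_mx !tr_col_mx !mul_mx_row ww wb (tr0 wb) b1.
  by rewrite -[LHS]/(block_mx _ _ _ _) -scalar_mx_block.
- rewrite !mul_col_mx !tr_col_mx !mul_mx_row wwJ wJ bJ.
  have -> : b *m h *m (w *m J)^T = 0 by apply: tr0; rewrite skJ wJ oppr0.
  by rewrite !row_mx0 col_mx0.
- by rewrite !mul_col_mx wT bT col_mx0.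
Qed.

Lemma para_signature : exists n, signature h n.+1 n.
Proof.
have F0 : family 0 by exists 0; split; apply/matrixP => -[].
have step j : family j \/ exists2 k, family k & (m <= 1 + k + k)%N.
  elim: j => [|j [Fj|]]; [by left| |by right].
  have [lt|ge] := ltnP (1 + j + j) m; first by left; exact: family_step.
  by right; exists j.
(* After [m] steps either the frame has already filled the space, or [family m] itself satisfies the
   bound. *)
have [k [b [b1 bJ bT]] mk] : exists2 k, family k & (m <= 1 + k + k)%N.
  have [Fm|//] := step m; exists m => //.
  by rewrite add1n addSn leqW // leq_addr.
have G := frame_gram b1 bJ bT.
have mE : m = (k.+1 + k)%N by apply/eqP; rewrite eqn_leq mk (frame_size G).
by exists k; exact: signature_of_gram mE G.
Qed.

End Signature.

(** * Para-quaternionic triples *)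

Section Quaternionic.
Variables (R : realType) (m : nat).
Implicit Types (h : 'M[R]_m) (f : 'End('rV[R]_m)) (T v w : 'rV[R]_m).

(** With f_a = nabla T_a at a point, these are the para-quaternionic relations of the J_a on the
    cone, written on the whole tangent space of M. The rank-one terms extend the relations beyond
    [E]; as T1 and T2 are time-like of square -1, [v + ip h v T1 *: T1] is the projection to the
    orthogonal of T1. *)
Definition quaternionic h f1 f2 f3 T1 T2 T3 : Prop :=
  [/\ [/\ ip h T1 T1 = -1, ip h T2 T2 = -1 & ip h T1 T2 = 0],
      [/\ f1 T1 = 0, f2 T2 = 0, f1 T2 = T3 & f2 T1 = - T3],
      (forall v, f1 (f1 v) = v + ip h v T1 *: T1) /\
        (forall v, f2 (f2 v) = v + ip h v T2 *: T2) &
      (forall v, f1 (f2 v) = f3 v + ip h v T2 *: T1) /\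
        (forall v, f2 (f1 v) = - f3 v + ip h v T1 *: T2)].

Definition skew_end h f := forall u v, ip h (f u) v = - ip h u (f v).

(** Exchanging the first two members reverses the third; facts about T1 thereby transfer to T2. *)
Lemma quaternionic_swap h f1 f2 f3 T1 T2 T3 : h^T = h ->
  quaternionic h f1 f2 f3 T1 T2 T3 -> quaternionic h f2 f1 (- f3) T2 T1 (- T3).
Proof.
move=> hT [[g11 g22 g12] [t1 t2 t12 t21] [q1 q2] [q12 q21]].
split; [|by split; rewrite ?t21 ?t12 ?opprK|by []|].
  by split=> //; rewrite ipC.
by split=> v; rewrite ?q12 ?q21 opp_lfunE ?opprK.
Qed.

Definition rank1 h u w : 'End('rV[R]_m) := linfun (mulmxr (h *m u^T *m w)).

Lemma rank1E h u w v : rank1 h u w v = ip h v u *: w.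
Proof.
rewrite /rank1 lfunE /= mulmxA (mulmxA v) /ip.
by rewrite [X in X *m w]mx11_scalar mul_scalar_mx.
Qed.

Section Consequences.
Variables (h : 'M[R]_m) (f1 f2 f3 : 'End('rV[R]_m)) (T1 T2 T3 : 'rV[R]_m).
Hypotheses (hT : h^T = h) (k1 : skew_end h f1) (k2 : skew_end h f2)
  (Q : quaternionic h f1 f2 f3 T1 T2 T3).

Let g11 : ip h T1 T1 = -1. Proof. by case: Q => -[]. Qed.
Let g22 : ip h T2 T2 = -1. Proof. by case: Q => -[]. Qed.
Let g12 : ip h T1 T2 = 0. Proof. by case: Q => -[]. Qed.
Let g21 : ip h T2 T1 = 0. Proof. by rewrite ipC. Qed.
Let t1 : f1 T1 = 0. Proof. by case: Q => _ []. Qed.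
Let t2 : f2 T2 = 0. Proof. by case: Q => _ []. Qed.
Let t12 : f1 T2 = T3. Proof. by case: Q => _ []. Qed.
Let t21 : f2 T1 = - T3. Proof. by case: Q => _ []. Qed.
Let q1 v : f1 (f1 v) = v + ip h v T1 *: T1. Proof. by case: Q => _ _ []. Qed.
Let q2 v : f2 (f2 v) = v + ip h v T2 *: T2. Proof. by case: Q => _ _ []. Qed.
Let q12 v : f1 (f2 v) = f3 v + ip h v T2 *: T1. Proof. by case: Q => _ _ _ []. Qed.
Let q21 v : f2 (f1 v) = - f3 v + ip h v T1 *: T2. Proof. by case: Q => _ _ _ []. Qed.

Lemma quat_t13 : f1 T3 = T2.
Proof. by rewrite -t12 q1 g21 scale0r addr0. Qed.

Lemma quat_t23 : f2 T3 = - T1.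
Proof. by rewrite -[T3]opprK -t21 linearN /= q2 g12 scale0r addr0. Qed.

Lemma quat_g33 : ip h T3 T3 = 1.
Proof. by rewrite -{1}t12 k1 quat_t13 g22 opprK. Qed.

Lemma quat_g13 : ip h T1 T3 = 0.
Proof. by rewrite -t12 -[LHS]opprK -k1 t1 ip0l oppr0. Qed.

Lemma quat_g23 : ip h T2 T3 = 0.
Proof. by rewrite -[T3]opprK -t21 ipNr -k2 t2 ip0l. Qed.

Lemma quat_t31 : f3 T1 = - T2.
Proof.
have := q12 T1; rewrite t21 linearN /= quat_t13 g12 scale0r addr0.
by move=> <-.
Qed.

Lemma quat_t32 : f3 T2 = T1.
Proof.
have := q12 T2; rewrite t2 linear0 g22 scaleN1r => /esym/eqP.
by rewrite subr_eq0 => /eqP.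
Qed.

Lemma quat_f1 v : [/\ ip h (f1 v) T1 = 0, ip h (f1 v) T2 = - ip h v T3 &
  ip h (f1 v) T3 = - ip h v T2].
Proof. by rewrite !k1 t1 t12 quat_t13 ip0r oppr0. Qed.

Lemma quat_f2 v : [/\ ip h (f2 v) T1 = ip h v T3, ip h (f2 v) T2 = 0 &
  ip h (f2 v) T3 = ip h v T1].
Proof. by rewrite !k2 t2 t21 quat_t23 ip0r !ipNr oppr0 !opprK. Qed.

Lemma quat_f3E v : f3 v = f1 (f2 v) - ip h v T2 *: T1.
Proof. by rewrite q12 addrK. Qed.

Lemma quat_f3 v : [/\ ip h (f3 v) T1 = ip h v T2, ip h (f3 v) T2 = - ip h v T1 &
  ip h (f3 v) T3 = 0].
Proof.
have [a1 a2 a3] := quat_f1 (f2 v); have [b1 b2 b3] := quat_f2 v.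
rewrite quat_f3E !ipDl !ipNl !ipZl a1 a2 a3 b2 b3 g11 g12 quat_g13.
by split; ring.
Qed.

Lemma quat_f3f3 v : f3 (f3 v) = - v + ip h v T3 *: T3.
Proof.
have E w : f3 w = - f2 (f1 w) + ip h w T1 *: T2 by rewrite q21 opprD opprK subrK.
rewrite E.
have -> : ip h (f3 v) T1 = ip h v T2 by have [] := quat_f3 v.
rewrite quat_f3E linearB linearZ /= t1 scaler0 subr0 q1 linearD linearZ /= q2 t21.
have [-> _ _] := quat_f2 v.
by apply/rowP => i; rewrite !mxE; ring.
Qed.

Lemma para_complex_perp : para_complex (orth h [:: T1]) f1.
Proof.
(* An endomorphism anticommuting with [f1] on the orthogonal of T1, which is larger than [E]. On [E]
   it is [f2]; since [f2] kills T2 and [f1] exchanges T2 and T3, the corrections make [K] send T2 to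
   T2 and T3 to -T3. *)
pose K : 'End('rV[R]_m) := f2 - rank1 h T2 T2 + rank1 h T3 T1 - rank1 h T3 T3.
have KE v : K v = f2 v - ip h v T2 *: T2 + ip h v T3 *: T1 - ip h v T3 *: T3.
  by rewrite /K !(add_lfunE, opp_lfunE, rank1E).
have [p1 p2] := (quat_f1, quat_f2).
have g31 : ip h T3 T1 = 0 by rewrite ipC // quat_g13.
have g32 : ip h T3 T2 = 0 by rewrite ipC // quat_g23.
have orthP v : v \in orth h [:: T1] -> ip h v T1 = 0 by rewrite mem_orth1 => /eqP.
have KK v : v \in orth h [:: T1] -> K (K v) = v.
  move=> /orthP v1; have [b1 b2 b3] := p2 v.
  rewrite [K (K v)]KE [K v]KE !(linearB, linearD, linearN, linearZ) /= q2 t2 t21 quat_t23.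
  rewrite !(ipDl, ipNl, ipZl) b2 b3 g22 g12 g32 quat_g23 quat_g13 quat_g33 v1.
  by apply/rowP => i; rewrite !mxE; ring.
apply: (@para_complex_swap _ _ _ _ K) => v.
- by rewrite !mem_orth1; have [-> _ _] := p1 v.
- by move=> /orthP v1; rewrite q1 v1 scale0r addr0.
- move=> _; rewrite mem_orth1 KE !(ipDl, ipNl, ipZl).
  by have [-> _ _] := p2 v; rewrite g21 g11 g31; apply/eqP; ring.
- by move=> vT Kv; rewrite -(KK v vT) Kv linear0.
- move=> /orthP v1; rewrite !KE !(linearB, linearD, linearN, linearZ) /= q12 q21 t1 t12.
  have [_ -> ->] := p1 v; rewrite quat_t13 v1.
  by apply/rowP => i; rewrite !mxE; ring.
Qed.

Lemma para_hyper_complex_orth : para_hyper_complex (orth h [:: T1; T2; T3]) f1 f2 f3.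
Proof.
have orthP v : v \in orth h [:: T1; T2; T3] <->
    [/\ ip h v T1 = 0, ip h v T2 = 0 & ip h v T3 = 0].
  rewrite mem_orth3; split=> [/and3P[/eqP ? /eqP ? /eqP ?] //|[-> -> ->]].
  by rewrite eqxx.
have q1' v : v \in orth h [:: T1; T2; T3] -> f1 (f1 v) = v.
  by move=> /orthP[v1 _ _]; rewrite q1 v1 scale0r addr0.
have q2' v : v \in orth h [:: T1; T2; T3] -> f2 (f2 v) = v.
  by move=> /orthP[_ v2 _]; rewrite q2 v2 scale0r addr0.
have s1 v : v \in orth h [:: T1; T2; T3] -> f1 v \in orth h [:: T1; T2; T3].
  by move=> /orthP[v1 v2 v3]; apply/orthP; have [-> -> ->] := quat_f1 v; rewrite v2 v3 oppr0.
have s2 v : v \in orth h [:: T1; T2; T3] -> f2 v \in orth h [:: T1; T2; T3].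
  by move=> /orthP[v1 v2 v3]; apply/orthP; have [-> -> ->] := quat_f2 v.
have a12 v : v \in orth h [:: T1; T2; T3] -> f1 (f2 v) = - f2 (f1 v).
  move=> /orthP[v1 v2 v3]; rewrite q12 q21 v1 v2.
  by apply/rowP => i; rewrite !mxE; ring.
split=> //.
- apply: (@para_complex_swap _ _ _ _ f2) => // v vE.
    by move=> f2v; rewrite -(q2' v vE) f2v linear0.
  by rewrite a12 // opprK.
- apply: (@para_complex_swap _ _ _ _ f1) => // v vE.
  by move=> f1v; rewrite -(q1' v vE) f1v linear0.
- by move=> v /orthP[_ v2 _]; rewrite q12 v2 scale0r addr0.
Qed.

End Consequences.
End Quaternionic.

(** * From para-3-Sasakian structures to the cone *)

Lemma smooth_endE (R : realType) (n : nat) (N : charted R n) (J : endfield N) :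
  smooth_end (fun=> fullv) J <-> smooth_endo J.
Proof.
split=> [H p X sX|H p X [sX _]].
  have [|//] := H p X; split=> //; apply: nearW => q; exact: memvf.
by split; [exact: H|apply: nearW => q; exact: memvf].
Qed.

Lemma skew_self (R : realType) (n : nat) (N : charted R n) (h : N -> 'M[R]_n)
    (J : endfield N) (p : N) e :
  (h p)^T = h p -> skew h J -> ip (h p) (J p e) e = 0.
Proof. by move=> hp kJ; have := kJ p e e; rewrite (ipC e _ hp) => ?; lra. Qed.

Section Correspondence.
Variables (R : realType) (m : nat) (M : charted R m).
Variables (g : M -> 'M[R]_m) (D : vfield M -> endfield M)
  (hD : vfield (cone M) -> endfield (cone M)).
Hypotheses (HM : C1_atlas M) (Hg : pseudo_riemannian g)
  (HD : levi_civita g D) (HhD : levi_civita (cone_metric g) hD).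
Implicit Types (z : cone M) (p : M) (a b : R) (v w : 'rV[R]_m) (X Y T : vfield M).

Let HC := cone_C1_atlas HM.
Let gT p : (g p)^T = g p. Proof. by case: Hg. Qed.
Let gU p : g p \in unitmx. Proof. by case: Hg. Qed.
Let hT := cone_metric_sym Hg.
Let hU := cone_metric_unit Hg.
Let lift T := hD (cone_lift T).

(** The brackets and the vanishing torsion determine each nabla T_a on the span of T1, T2, T3, and
    the axioms give the relations on [E]; the two are assembled through the projection [e]. *)
Lemma para_3_sasakian_quaternionic T1 T2 T3 p :
  para_3_sasakian g D (T1, T2, T3) ->
  quaternionic (g p) (D T1 p) (D T2 p) (D T3 p) (T1 p) (T2 p) (T3 p).
Proof.
move=> [_ orthT [S1 S2 S3] T21 [brT [_ _ _ PHC]]].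
have [g12 g13 g23] := orthT p; have [br12 br13 br23] := brT p.
have [_ [s1 kill1] g11 geo1 [[_ pc1] _]] := S1.
have [_ [s2 kill2] g22 geo2 [[_ pc2] _]] := S2.
have [[s3 kill3] g33 phi33 _] := S3.
have /(killing_skewP HM HD s3) k3 := kill3.
have [[/subvP E1 sq1 _] [/subvP E2 sq2 _] anti comp] := PHC p.
have [_ p1 _] := pc1 p; have [_ p2 _] := pc2 p.
have t12 := T21 p.
have C x y := ipC x y (gT p).
have t21 : D T2 p (T1 p) = - T3 p.
  move: br12; rewrite (torsion_free HD (s1 p) (s2 p)) t12 => /(canRL (subrK _)) ->.
  by apply/rowP => i; rewrite !mxE; ring.
have t13 : D T1 p (T3 p) = T2 p by rewrite -t12 p1 // mem_orth1 C g12.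
have t23 : D T2 p (T3 p) = - T1 p.
  by rewrite -[T3 p]opprK -t21 linearN /= p2 // mem_orth1 g12.
have t31 : D T3 p (T1 p) = - T2 p.
  move: br13; rewrite (torsion_free HD (s1 p) (s3 p)) t13 => /(canRL (subrK _)) ->.
  by apply/rowP => i; rewrite !mxE; ring.
have t32 : D T3 p (T2 p) = T1 p.
  move: br23; rewrite (torsion_free HD (s2 p) (s3 p)) t23 => /(canRL (subrK _)) ->.
  by apply/rowP => i; rewrite !mxE; ring.
(* Put w = phi T3. Then phi w = phi^2 T3 = 0, while w is orthogonal to T3 by skewness, so 0 = phi^2
   w = -w. *)
have t33 : D T3 p (T3 p) = 0.
  have n0 : ip (g p) (D T3 p (T3 p)) (T3 p) = 0.
    by have := k3 p (T3 p) (T3 p); rewrite (C (T3 p)) => ?; lra.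
  have := phi33 p (T3 p); rewrite g33 scale1r addNr => E.
  have := phi33 p (D T3 p (T3 p)); rewrite E linear0 n0 scale0r addr0 => /esym/eqP.
  by rewrite oppr_eq0 => /eqP.
(* The projection to [E], with opposite sign for the space-like T3; only its equation is kept, so
   that [e v] is not unfolded by later rewriting. *)
have [e eV] : exists e : 'rV[R]_m -> 'rV[R]_m, forall v, e v =
    v + ip (g p) v (T1 p) *: T1 p + ip (g p) v (T2 p) *: T2 p
      - ip (g p) v (T3 p) *: T3 p by eexists=> v; reflexivity.
have eE v : e v \in orth (g p) [:: T1 p; T2 p; T3 p].
  rewrite mem_orth3 eV !(ipDl, ipNl, ipZl) (C (T2 p)) !(C (T3 p)) g11 g22 g33 g12 g13 g23.
  by apply/and3P; split; apply/eqP; ring.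
have ve v : v = e v - ip (g p) v (T1 p) *: T1 p - ip (g p) v (T2 p) *: T2 p
              + ip (g p) v (T3 p) *: T3 p.
  by rewrite eV; apply/rowP => i; rewrite !mxE; ring.
have F1 v : D T1 p v = D T1 p (e v) - ip (g p) v (T2 p) *: T3 p + ip (g p) v (T3 p) *: T2 p.
  rewrite [in LHS](ve v) !(linearD, linearN, linearZ) /= geo1 t12 t13.
  by apply/rowP => i; rewrite !mxE; ring.
have F2 v : D T2 p v = D T2 p (e v) + ip (g p) v (T1 p) *: T3 p - ip (g p) v (T3 p) *: T1 p.
  rewrite [in LHS](ve v) !(linearD, linearN, linearZ) /= geo2 t21 t23.
  by apply/rowP => i; rewrite !mxE; ring.
have F3 v : D T3 p v = D T3 p (e v) + ip (g p) v (T1 p) *: T2 p - ip (g p) v (T2 p) *: T1 p.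
  rewrite [in LHS](ve v) !(linearD, linearN, linearZ) /= t31 t32 t33.
  by apply/rowP => i; rewrite !mxE; ring.
split=> //; split=> v.
- rewrite [D T1 p v]F1 !(linearD, linearN, linearZ) /= sq1 // t12 t13 eV.
  by apply/rowP => i; rewrite !mxE; ring.
- rewrite [D T2 p v]F2 !(linearD, linearN, linearZ) /= sq2 // t21 t23 eV.
  by apply/rowP => i; rewrite !mxE; ring.
- rewrite [D T2 p v]F2 F3 !(linearD, linearN, linearZ) /= geo1 t13 comp //.
  by apply/rowP => i; rewrite !mxE; ring.
- rewrite [D T1 p v]F1 F3 !(linearD, linearN, linearZ) /= geo2 t23 comp // anti //.
  by apply/rowP => i; rewrite !mxE; ring.
Qed.

Lemma lift_lift T T' z a v : smooth_vfield T -> smooth_vfield T' ->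
  lift T z (lift T' z (cvec a v)) =
  cvec (- radius z * ip (g z.2) (T z.2) (D T' z.2 v + (a / radius z) *: T' z.2))
    (D T z.2 (D T' z.2 v + (a / radius z) *: T' z.2) - ip (g z.2) (T' z.2) v *: T z.2).
Proof.
move=> sT sT'; rewrite /lift (conn_lift HM Hg HD HhD _ _ (sT' _)).
rewrite (conn_lift HM Hg HD HhD _ _ (sT _)); congr cvec; congr (_ + _).
rewrite mulrAC mulNr divff ?gt_eqF ?radius_gt0 // mulN1r scaleNr //.
Qed.

Section Triple.
Variables T1 T2 T3 : vfield M.
Hypotheses (s1 : smooth_vfield T1) (s2 : smooth_vfield T2) (s3 : smooth_vfield T3)
  (k1 : skew g (D T1)) (k2 : skew g (D T2)).

Let quat p := quaternionic (g p) (D T1 p) (D T2 p) (D T3 p) (T1 p) (T2 p) (T3 p).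

Lemma quaternionic_cone z : quat z.2 ->
  [/\ forall u, lift T1 z (lift T1 z u) = u,
      forall u, lift T2 z (lift T2 z u) = u,
      forall u, lift T1 z (lift T2 z u) = lift T3 z u &
      forall u, lift T2 z (lift T1 z u) = - lift T3 z u].
Proof.
set p := z.2; set r := radius z => Q.
have r0 : r != 0 by rewrite gt_eqF // radius_gt0.
have C x y := ipC x y (gT p).
have q1 v := quat_f1 (gT p) (k1 p) Q v; have q2 v := quat_f2 (k2 p) Q v.
have [[g11 g22 g12] [t1 t2 t12 t21] [q11 q22] [q12 q21]] := Q.
split=> u; rewrite [u]cvecP; set a := lsubmx u 0 0; set v := rsubmx u;
  rewrite lift_lift //;
  try rewrite [lift T3 z _](conn_lift HM Hg HD HhD _ _ (s3 _)) ?cvecN; congr cvec;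
  rewrite -/p -/r ?linearD ?linearZ /= ?ipDr ?ipZr ?(C _ (D _ _ _)).
- by have [-> _ _] := q1 v; rewrite g11; field.
- by rewrite q11 t1 (C (T1 p)); apply/rowP => i; rewrite !mxE; ring.
- by have [_ -> _] := q2 v; rewrite g22; field.
- by rewrite q22 t2 (C (T2 p)); apply/rowP => i; rewrite !mxE; ring.
- by have [-> _ _] := q2 v; rewrite g12 (C v); field.
- by rewrite q12 t12 (C (T2 p)); apply/rowP => i; rewrite !mxE; ring.
- by have [_ -> _] := q1 v; rewrite (C (T2 p)) g12 (C v) [RHS]mulrN; field.
- by rewrite q21 t21 (C (T1 p)); apply/rowP => i; rewrite !mxE; ring.
Qed.

(** Evaluation on r d/dr yields the inner products and the values nabla_(T_b) T_a; evaluation on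
    vectors tangent to M yields the relations between the nabla T_a, the rank-one terms arising from
    the radial component of J v. *)
Lemma cone_quaternionic z :
  (forall u, lift T1 z (lift T1 z u) = u) -> (forall u, lift T2 z (lift T2 z u) = u) ->
  (forall u, lift T1 z (lift T2 z u) = lift T3 z u) ->
  (forall u, lift T2 z (lift T1 z u) = - lift T3 z u) -> quat z.2.
Proof.
set p := z.2; set r := radius z => J11 J22 J12 J21.
have r0 : r != 0 by rewrite gt_eqF // radius_gt0.
have C x y := ipC x y (gT p).
have rr x : - r * x = r -> x = -1.
  by move=> E; apply: (mulfI r0); rewrite mulrN1 -{2}E mulNr opprK.
have r00 x : - r * x = 0 -> x = 0.
  by move=> /eqP; rewrite mulf_eq0 oppr_eq0 (negPf r0) => /eqP.
have L0 T T' v : smooth_vfield T -> smooth_vfield T' ->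
    lift T z (lift T' z (cvec 0 v)) = cvec (- r * ip (g p) (T p) (D T' p v))
      (D T p (D T' p v) - ip (g p) v (T' p) *: T p).
  by move=> sT sT'; rewrite lift_lift // mul0r scale0r addr0 (C v).
have Lr T T' : smooth_vfield T -> smooth_vfield T' ->
    lift T z (lift T' z (cvec r 0)) = cvec (- r * ip (g p) (T p) (T' p)) (D T p (T' p)).
  move=> sT sT'; rewrite lift_lift // divff // scale1r linear0 add0r ip0r scale0r.
  by rewrite subr0.
have E3 a v : lift T3 z (cvec a v) =
    cvec (- r * ip (g p) (T3 p) v) (D T3 p v + (a / r) *: T3 p).
  exact: (conn_lift HM Hg HD HhD _ _ (s3 _)).
have E30 v : lift T3 z (cvec 0 v) = cvec (- r * ip (g p) (T3 p) v) (D T3 p v).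
  by rewrite E3 mul0r scale0r addr0.
have E3r : lift T3 z (cvec r 0) = cvec 0 (T3 p).
  by rewrite E3 ip0r mulr0 linear0 add0r divff // scale1r.
split.
- have := J11 (cvec r 0); have := J22 (cvec r 0); have := J12 (cvec r 0).
  rewrite !Lr // E3r => /cvec_inj[/r00 g12 _] /cvec_inj[/rr g22 _] /cvec_inj[/rr g11 _].
  by split.
- have := J11 (cvec r 0); have := J22 (cvec r 0); have := J12 (cvec r 0).
  have := J21 (cvec r 0); rewrite !Lr // E3r cvecN.
  by move=> /cvec_inj[_ t21] /cvec_inj[_ t12] /cvec_inj[_ t2] /cvec_inj[_ t1].
- split=> v.
    by have := J11 (cvec 0 v); rewrite L0 // => /cvec_inj[_ /(canRL (subrK _))].
  by have := J22 (cvec 0 v); rewrite L0 // => /cvec_inj[_ /(canRL (subrK _))].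
- split=> v.
    by have := J12 (cvec 0 v); rewrite L0 // E30 => /cvec_inj[_ /(canRL (subrK _))].
  by have := J21 (cvec 0 v); rewrite L0 // E30 cvecN => /cvec_inj[_ /(canRL (subrK _))].
Qed.

End Triple.

Lemma cov_at_cone T z u x : smooth_vfield T -> skew g (D T) ->
  cov_at hD (lift T) z u x =
  cvec 0 (cov_at D (D T) z.2 (rsubmx u) (rsubmx x)
          - ip (g z.2) (rsubmx x) (T z.2) *: rsubmx u
          + ip (g z.2) (rsubmx x) (rsubmx u) *: T z.2).
Proof.
move=> sT kT; have sX := smooth_extension HM z.2 (rsubmx x).
rewrite {1}/cov_at (cov_end_cone HM Hg HD HhD sT kT u (smooth_extension HC z x) sX).
  by rewrite (extension_self HM).
by rewrite (extension_self HC) (extension_self HM).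
Qed.

(** For eigensections X and Y of phi = nabla T, (nabla_u phi) X = (c - phi) nabla_u X. Exchanging
    the arguments changes the result by (c - phi) [X, Y], which vanishes by involutivity. *)
Lemma para_sasakian_symmetric T p (c : R) A B : para_sasakian g D T ->
  c = 1 \/ c = -1 -> D T p A = c *: A -> D T p B = c *: B ->
  cov_at D (D T) p A B = cov_at D (D T) p B A.
Proof.
move=> [_ [sT kill] g11 geo [[_ pc] [inv_p inv_m]]] Hc TA TB.
have /(killing_skewP HM HD sT) kT := kill.
have c1 : c * c = 1 by case: Hc => ->; rewrite ?mulr1 ?mulrNN ?mulr1.
have sJ := smooth_endo_conn HD sT.
have perp q v : D T q v \in orth (g q) [:: T q].
  by rewrite mem_orth1 kT geo ip0r oppr0.
(* Here phi^2 projects to the orthogonal of [T] and (1 + c phi) / 2 then to the eigenspace for [c];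
   the composite (phi^2 + c phi) / 2 gives sections that keep the value of an eigenvector at [p]. *)
pose X w q := 2^-1 *: (D T q (D T q (extension p w q)) + c *: D T q (extension p w q)).
have sE w := smooth_extension HM p w.
have sX w : smooth_field (X w) p.
  apply: (smooth_fieldZc HM); apply: (smooth_fieldD HM); first exact/sJ/sJ.
  exact/(smooth_fieldZc HM)/sJ.
have XT w q : X w q \in orth (g q) [:: T q] by rewrite memvZ // memvD // memvZ.
have TX w q : D T q (X w q) = c *: X w q.
  rewrite linearZ linearD linearZ /=; have [_ -> // _] := pc q.
  by apply/rowP => i; rewrite !mxE; ring: c1.
have Xp w : D T p w = c *: w -> X w p = w.
  move=> Tw; rewrite /X (extension_self HM) Tw linearZ /= Tw.
  by apply/rowP => i; rewrite !mxE; field: c1.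
have TXb v w : D T p (bracket (X v) (X w) p) = c *: bracket (X v) (X w) p.
  have sec (W : distribution M) : (forall u q, X u q \in W q) -> forall u, is_section W (X u) p.
    by move=> XW u; split=> //; apply: nearW => q; exact: XW.
  case: Hc => c_; rewrite c_ in TX *.
    have XW u q : X u q \in (orth (g q) [:: T q] :&: eigen_plus (D T q))%VS.
      by rewrite memv_cap XT; apply/eigen_plusP; rewrite TX scale1r.
    have := inv_p p _ _ (sec _ XW v) (sec _ XW w).
    by rewrite memv_cap => /andP[_ /eigen_plusP ->]; rewrite scale1r.
  have XW u q : X u q \in (orth (g q) [:: T q] :&: eigen_minus (D T q))%VS.
    by rewrite memv_cap XT; apply/eigen_minusP; rewrite TX scaleN1r.
  have := inv_m p _ _ (sec _ XW v) (sec _ XW w).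
  by rewrite memv_cap => /andP[_ /eigen_minusP ->]; rewrite scaleN1r.
have covX u w : D T p w = c *: w -> cov_at D (D T) p u w =
    c *: D (X w) p u - D T p (D (X w) p u).
  move=> Tw; rewrite -{1}(Xp w Tw) -(cov_endE HM gU HD _ sJ kT (sX w)) /cov_end.
  rewrite (_ : (fun q => _) = (fun q => c *: X w q)); last by apply/funext => q; exact: TX.
  by case: HD => Hconn _ _; rewrite (connZc HM Hconn).
apply/eqP; rewrite -subr_eq0 (covX A B) // (covX B A) //.
have := TXb A B; rewrite (torsion_free HD (sX A) (sX B)) !Xp // linearB scalerBr /=.
move=> /eqP; rewrite -subr_eq0 -oppr_eq0 => /eqP <-.
by apply/eqP/rowP => i; rewrite !mxE; ring.
Qed.

(** An eigenvector x of [J] orthogonal to d/dr is tangent to M, and the radial part of J x = c x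
    gives g(x, T) = 0. In [cov_at_cone] this leaves the derivative on M and the symmetric term g(A,
    B) T. *)
Lemma lift_symmetric T z (c : R) A B : para_sasakian g D T ->
  c = 1 \/ c = -1 -> lift T z A = c *: A -> lift T z B = c *: B ->
  ip (cone_metric g z) A (cvec 1 0) = 0 -> ip (cone_metric g z) B (cvec 1 0) = 0 ->
  cov_at hD (lift T) z A B = cov_at hD (lift T) z B A.
Proof.
move=> PS Hc; have [_ [sT kill] _ _ _] := PS.
have /(killing_skewP HM HD sT) kT := kill.
have r0 : radius z != 0 by rewrite gt_eqF // radius_gt0.
have red x : lift T z x = c *: x -> ip (cone_metric g z) x (cvec 1 0) = 0 ->
    D T z.2 (rsubmx x) = c *: rsubmx x /\ ip (g z.2) (rsubmx x) (T z.2) = 0.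
  rewrite {1 2 3}[x]cvecP ip_cone ip0r mulr0 addr0 mulr1 => + x0; rewrite x0.
  rewrite /lift (conn_lift HM Hg HD HhD _ _ (sT _)) cvecZ mul0r scale0r addr0 mulr0.
  move=> /cvec_inj[/eqP + ->]; rewrite mulf_eq0 oppr_eq0 (negPf r0) => /eqP E.
  by rewrite ipC.
move=> JA JB Ae Be; have [fA TA] := red A JA Ae; have [fB TB] := red B JB Be.
rewrite !(cov_at_cone _ _ _ sT kT) TA TB !scale0r !subr0 (para_sasakian_symmetric PS Hc fA fB).
by rewrite (ipC (rsubmx B)).
Qed.

Lemma para_3_sasakian_cone T1 T2 T3 : para_3_sasakian g D (T1, T2, T3) ->
  para_hyper_kahler (cone_metric g) hD (lift T1, lift T2, lift T3).
Proof.
move=> H; have Q p := para_3_sasakian_quaternionic p H.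
have [_ _ [PS1 PS2 SS3] _ _] := H.
have [_ [s1 kill1] _ _ _] := PS1; have [_ [s2 kill2] _ _ _] := PS2.
have [[s3 kill3] _ _ phi3] := SS3.
have /(killing_skewP HM HD s1) k1 := kill1.
have /(killing_skewP HM HD s2) k2 := kill2.
have /(killing_skewP HM HD s3) k3 := kill3.
have rel z := quaternionic_cone s1 s2 s3 k1 k2 (Q z.2).
have J11 z u : lift T1 z (lift T1 z u) = u by have [] := rel z.
have J22 z u : lift T2 z (lift T2 z u) = u by have [] := rel z.
have J12 z u : lift T1 z (lift T2 z u) = lift T3 z u by have [] := rel z.
have J21 z u : lift T2 z (lift T1 z u) = - lift T3 z u by have [] := rel z.
have J32 z u : lift T3 z (lift T2 z u) = lift T1 z u by rewrite -J12 J22.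
have J13 z u : lift T1 z (lift T3 z u) = lift T2 z u by rewrite -J12 J11.
have J31 z u : lift T3 z (lift T1 z u) = - lift T2 z u.
  by rewrite -J12 J21 linearN /= J13.
have J23 z u : lift T2 z (lift T3 z u) = - lift T1 z u by rewrite -J12 J21 J32.
have J33 z u : lift T3 z (lift T3 z u) = - u.
  by rewrite -{1}J12 J23 linearN /= J11.
have sJ T (sT : smooth_vfield T) := smooth_endo_lift HM HhD sT.
have kJ T (sT : smooth_vfield T) (kT : skew g (D T)) := skew_lift HM Hg HD HhD sT kT.
have sJ1 := sJ _ s1; have sJ2 := sJ _ s2; have sJ3 := sJ _ s3.
have kJ1 := kJ _ s1 k1; have kJ2 := kJ _ s2 k2; have kJ3 := kJ _ s3 k3.
have S3 z u x : cov_at hD (lift T3) z u x = 0.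
  rewrite (cov_at_cone _ _ _ s3 k3) {1}/cov_at (phi3 _ _ (smooth_extension HM _ _)).
  rewrite (extension_self HM) (ipC (rsubmx x) (rsubmx u)) //.
  by rewrite -cvec0; congr cvec; apply/rowP => i; rewrite !mxE; ring.
have S1E z u x : cov_at hD (lift T1) z u x = lift T3 z (cov_at hD (lift T2) z u x).
  have E q (v : 'rV[R]_(1 + m)) : lift T1 q v = lift T3 q (lift T2 q v) by rewrite J32.
  by rewrite (cov_at_compose HC hU HhD z u x E sJ3 kJ3 sJ2) S3 add0r.
have S2E z u x : cov_at hD (lift T2) z u x = cov_at hD (lift T1) z u (lift T3 z x).
  have E q (v : 'rV[R]_(1 + m)) : lift T2 q v = lift T1 q (lift T3 q v) by rewrite J13.
  by rewrite (cov_at_compose HC hU HhD z u x E sJ1 kJ1 sJ3) S3 linear0 addr0.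
have lin T z a (u x y : 'rV[R]_(1 + m)) : smooth_vfield T -> skew g (D T) ->
    cov_at hD (lift T) z u (a *: x + y) =
    a *: cov_at hD (lift T) z u x + cov_at hD (lift T) z u y.
  by move=> sT kT; exact: (cov_at_linear HC hU HhD z a u x y (sJ _ sT) (kJ _ sT kT)).
have linl T z a (u v x : 'rV[R]_(1 + m)) : cov_at hD (lift T) z (a *: u + v) x =
    a *: cov_at hD (lift T) z u x + cov_at hD (lift T) z v x.
  exact: cov_at_linearl.
pose e : 'rV[R]_(1 + m) := cvec 1 0.
have re : rsubmx e = 0 by rewrite /e /cvec row_mxKr.
have Se T z u : smooth_vfield T -> skew g (D T) -> cov_at hD (lift T) z u e = 0.
  move=> sT kT; rewrite (cov_at_cone _ _ _ sT kT) re !ip0l.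
  rewrite (cov_at0r HM gU HD _ _ (smooth_endo_conn HD sT) kT).
  by rewrite !scale0r subr0 addr0 cvec0.
have eS T z x : smooth_vfield T -> skew g (D T) -> cov_at hD (lift T) z e x = 0.
  move=> sT kT; rewrite (cov_at_cone _ _ _ sT kT) re ip0r cov_at0l.
  by rewrite scale0r scaler0 subr0 addr0 cvec0.
have ee z : ip (cone_metric g z) e e = 1 by rewrite ip_cone ip0r mulr0 addr0 mulr1.
(* Used with T3 for [T'] both times: J3 anticommutes with J1 and J2 as well as with S1 and S2. *)
have van T T' z : para_sasakian g D T -> smooth_vfield T -> skew g (D T) ->
    (forall u, lift T z (lift T z u) = u) ->
    (forall u, lift T' z (lift T z u) = - lift T z (lift T' z u)) ->
    (forall u, lift T' z u = 0 -> u = 0) ->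
    (forall u x, cov_at hD (lift T) z u (lift T z x) = - lift T z (cov_at hD (lift T) z u x)) ->
    (forall u x, cov_at hD (lift T) z u (lift T' z x) = - lift T' z (cov_at hD (lift T) z u x)) ->
    forall A, ip (cone_metric g z) A e = 0 ->
      ip (cone_metric g z) A (lift T z e) = 0 ->
    forall x, cov_at hD (lift T) z A x = 0.
  move=> PS sT kT JJ JJ' J'inj SJ SJ'.
  apply: (@integrable_vanish2 _ _ (cone_metric g z) (lift T z) (lift T' z)
    (cov_at hD (lift T) z) e (hU z) (hT z) _ JJ JJ' J'inj _ _ _ SJ SJ' (ee z)).
  - by move=> u v; exact: (kJ _ sT kT z u v).
  - by move=> a u v w; exact: (lin _ z a u v w sT kT).
  - by move=> a u v w; exact: linl.
  - by move=> u v w; exact: (cov_at_skew HC HhD z u v w (sJ _ sT) (kJ _ sT kT)).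
  - by move=> u; exact: (Se _ z u sT kT).
  - by move=> c A B Hc JA JB; exact: (lift_symmetric PS Hc JA JB).
have J3inj z u : lift T3 z u = 0 -> u = 0.
  by move=> E; apply: oppr_inj; rewrite oppr0 -(J33 z u) E linear0.
have V1 z : forall A, ip (cone_metric g z) A e = 0 ->
      ip (cone_metric g z) A (lift T1 z e) = 0 ->
    forall x, cov_at hD (lift T1) z A x = 0.
  apply: (van T1 T3 z PS1 s1 k1 (J11 z)) => [u|u|u x|u x].
  - by rewrite J31 J13.
  - exact: J3inj.
  - exact: (cov_at_involution HC hU HhD z u x J11 sJ1 kJ1).
  - apply: (etrans (esym (S2E z u x))); apply: oppr_inj; rewrite [RHS]opprK.
    apply: esym; apply: (etrans (congr1 (lift T3 z) (S1E z u x))).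
    exact: J33.
have V2 z : forall A, ip (cone_metric g z) A e = 0 ->
      ip (cone_metric g z) A (lift T2 z e) = 0 ->
    forall x, cov_at hD (lift T2) z A x = 0.
  apply: (van T2 T3 z PS2 s2 k2 (J22 z)) => [u|u|u x|u x].
  - by rewrite J32 J23 opprK.
  - exact: J3inj.
  - exact: (cov_at_involution HC hU HhD z u x J22 sJ2 kJ2).
  - rewrite S2E J33 -S1E -[- x]addr0 -scaleN1r (lin _ _ _ _ _ _ s1 k1).
    by rewrite (cov_at0r HC hU HhD _ _ sJ1 kJ1) addr0 scaleN1r.
have S1 z u x : cov_at hD (lift T1) z u x = 0.
  have J1e : ip (cone_metric g z) (lift T1 z e) e = 0 by exact: (skew_self _ (hT z) kJ1).
  have J1J1 : ip (cone_metric g z) (lift T1 z e) (lift T1 z e) = -1.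
    by rewrite kJ1 J11 ee.
  have J1J2 : ip (cone_metric g z) (lift T1 z e) (lift T2 z e) = 0.
    by rewrite kJ1 J12 (ipC e _ (hT z)) (skew_self _ (hT z) kJ3) oppr0.
  have eJ1 : ip (cone_metric g z) e (lift T1 z e) = 0 by rewrite ipC.
  (* The component of [u] orthogonal to [e] and J1 e; the plus sign is due to J1 e having square
     -1. *)
  pose A := u - ip (cone_metric g z) u e *: e
              + ip (cone_metric g z) u (lift T1 z e) *: lift T1 z e.
  have uE : u = ip (cone_metric g z) u e *: e +
      (- ip (cone_metric g z) u (lift T1 z e) *: lift T1 z e + A).
    by rewrite /A; apply/rowP => i; rewrite !mxE; ring.
  have Z1 : cov_at hD (lift T1) z (lift T1 z e) x = 0.
    by apply: (etrans (S1E z _ x)); rewrite (V2 _ _ J1e J1J2) linear0.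
  rewrite uE !linl Z1 (eS _ _ _ s1 k1) !scaler0 !add0r.
  by apply: V1; rewrite /A !(ipDl, ipNl, ipZl) ?J1e ?ee ?J1J1 ?eJ1; ring.
have S2 z u x : cov_at hD (lift T2) z u x = 0 by rewrite S2E S1.
split.
- split; [exact: (smooth_endE (lift T1)).2 sJ1|exact: (smooth_endE (lift T2)).2 sJ2|
            exact: (smooth_endE (lift T3)).2 sJ3|] => z.
  split=> [||v _|v _]; last 2 first.
  + by rewrite J21 J12 opprK.
  + by rewrite J12.
  + apply: (@para_complex_swap _ _ _ _ (lift T2 z)) => v _;
      [exact: memvf|exact: J11|exact: memvf| |by rewrite J21 J12].
    by move=> E; rewrite -(J22 z v) E linear0.
  + apply: (@para_complex_swap _ _ _ _ (lift T1 z)) => v _;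
      [exact: memvf|exact: J22|exact: memvf| |by rewrite J21 J12 opprK].
    by move=> E; rewrite -(J11 z v) E linear0.
- exact: And3 kJ1 kJ2 kJ3.
- split.
  + by apply/(parallelP HC hU HhD sJ1 kJ1) => z u x; exact: S1.
  + by apply/(parallelP HC hU HhD sJ2 kJ2) => z u x; exact: S2.
  + by apply/(parallelP HC hU HhD sJ3 kJ3) => z u x; exact: S3.
Qed.

End Correspondence.

(** * From the cone to para-3-Sasakian structures *)

Lemma ip_mx_inj (R : realType) (m : nat) (A B : 'M[R]_m) :
  (forall u v, ip A u v = ip B u v) -> A = B.
Proof.
move=> AB; apply/matrixP => i j; have := AB (delta_mx 0 i) (delta_mx 0 j).
by rewrite /ip trmx_delta -!rowE -!colE !mxE.
Qed.

Section Converse.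
Variables (R : realType) (m : nat) (M : charted R m).
Variables (g : M -> 'M[R]_m) (D : vfield M -> endfield M)
  (hD : vfield (cone M) -> endfield (cone M)).
Hypotheses (HMan : is_manifold M) (Hg : pseudo_riemannian g)
  (HD : levi_civita g D) (HhD : levi_civita (cone_metric g) hD).
Implicit Types (z : cone M) (p : M) (a b : R) (v w : 'rV[R]_m) (X Y T : vfield M).

Let HM := manifold_C1_atlas HMan.
Let HC := cone_C1_atlas HM.
Let gT p : (g p)^T = g p. Proof. by case: Hg. Qed.
Let gU p : g p \in unitmx. Proof. by case: Hg. Qed.
Let hU := cone_metric_unit Hg.
Let lift T := hD (cone_lift T).
Let Hconn : is_connection D. Proof. by case: HD. Qed.

(** Turns a neighbourhood in M into an open set of coordinates, the form in which [conn_local]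
    expresses locality; this uses the continuity of the inverse chart. *)
Lemma near_chart p (P : M -> Prop) : (\forall q \near p, P q) ->
  exists U : set 'rV[R]_m, [/\ open U, U (coord (chart_at p) p) &
    forall q, dom (chart_at p) q -> U (coord (chart_at p) q) -> P q].
Proof.
move=> NP; pose A := inv_coord (chart_at p) @^-1` [set q | P q].
have [_ _ _ Hc _] := HMan; have [[_ _ _ _ ci] _] := Hc p.
have NA : nbhs (coord (chart_at p) p) A.
  by apply: (ci _ (img_self HM p)); rewrite (inv_coord_self HM).
exists (interior A); split; [exact: open_interior|exact: NA|].
by move=> q dq /interior_subset; rewrite /A /= (coordK HM dq).
Qed.

(** For a local eigenfield Z of phi = nabla T, the formula for nabla phi gives phi (nabla_u Z) = c
    nabla_u Z + g(Z, u) T. In [X, Y] the terms g(X, Y) T cancel, so the bracket is again an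
    eigenvector. *)
Lemma para_sasakian_of T : smooth_vfield T -> skew g (D T) ->
  (exists n, forall p, signature (g p) n.+1 n) ->
  (forall p, ip (g p) (T p) (T p) = -1) -> (forall p, D T p (T p) = 0) ->
  (forall p, para_complex (orth (g p) [:: T p]) (D T p)) ->
  (forall p u x, cov_at D (D T) p u x =
     ip (g p) x (T p) *: u - ip (g p) x u *: T p) ->
  para_sasakian g D T.
Proof.
move=> sT kT sig unit geo pc cov.
have sJ := smooth_endo_conn HD sT.
have perp q v : ip (g q) (D T q v) (T q) = 0 by rewrite kT geo ip0r oppr0.
have inv (c : R) p X Y : c = 1 \/ c = -1 -> smooth_field X p -> smooth_field Y p ->
    (\forall q \near p, ip (g q) (X q) (T q) = 0 /\ D T q (X q) = c *: X q) ->
    (\forall q \near p, ip (g q) (Y q) (T q) = 0 /\ D T q (Y q) = c *: Y q) ->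
    ip (g p) (bracket X Y p) (T p) = 0 /\
    D T p (bracket X Y p) = c *: bracket X Y p.
  move=> Hc sX sY NX NY.
  have c0 : c != 0 by case: Hc => ->; rewrite ?oppr_eq0 oner_eq0.
  have DT Z u : smooth_field Z p ->
      (\forall q \near p, ip (g q) (Z q) (T q) = 0 /\ D T q (Z q) = c *: Z q) ->
      D T p (D Z p u) = c *: D Z p u + ip (g p) (Z p) u *: T p.
    move=> sZ NZ; have [Zp _] := nbhs_singleton NZ.
    have [U [oU Up HU]] := near_chart NZ.
    have := cov p u (Z p); rewrite -(cov_endE HM gU HD u sJ kT sZ) /cov_end.
    (* The eigenvector equation for [Z] holds only near [p], so the two fields are compared by
       locality of the connection. *)
    have loc : D (fun q => D T q (Z q)) p = D (fun q => c *: Z q) p.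
      apply: (conn_local HM Hconn oU Up _ (sJ _ _ sZ) (smooth_fieldZc HM c sZ)).
      by move=> q dq Uq; have [] := HU q dq Uq.
    rewrite loc (connZc HM Hconn _ _ sZ) Zp scale0r sub0r => /eqP.
    rewrite subr_eq => /eqP E; rewrite E addrAC addNr add0r.
    by [].
  have E : D T p (bracket X Y p) = c *: bracket X Y p.
    rewrite (torsion_free HD sX sY) linearB /= (DT Y) // (DT X) //.
    rewrite (ipC (X p) (Y p)) // scalerBr.
    by apply/rowP => i; rewrite !mxE; ring.
  (* [c] times the bracket is an image under nabla T, hence orthogonal to [T]. *)
  by split=> //; apply: (mulfI c0); rewrite mulr0 -ipZl -E.
have memP q (v : 'rV[R]_m) : v \in orth (g q) [:: T q] <-> ip (g q) v (T q) = 0.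
  by rewrite mem_orth1; split=> /eqP.
split=> //.
- by split=> //; apply/(killing_skewP HM HD sT).
- split.
    split=> // p X [sX NX]; split; first exact: sJ.
    by apply: nearW => q; apply/memP; exact: perp.
  split=> p X Y [sX NX] [sY NY].
    have W Z : (\forall q \near p, Z q \in (orth (g q) [:: T q] :&: eigen_plus (D T q))%VS) ->
        \forall q \near p, ip (g q) (Z q) (T q) = 0 /\ D T q (Z q) = 1 *: Z q.
      apply: nbhsS => q; rewrite memv_cap => /andP[/memP ? /eigen_plusP ->].
      by rewrite scale1r.
    have [] := inv 1 p X Y (or_introl erefl) sX sY (W _ NX) (W _ NY).
    rewrite scale1r memv_cap => /memP -> E; exact/eigen_plusP.
  have W Z : (\forall q \near p, Z q \in (orth (g q) [:: T q] :&: eigen_minus (D T q))%VS) ->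
      \forall q \near p, ip (g q) (Z q) (T q) = 0 /\ D T q (Z q) = -1 *: Z q.
    apply: nbhsS => q; rewrite memv_cap => /andP[/memP ? /eigen_minusP ->].
    by rewrite scaleN1r.
  have [] := inv (-1) p X Y (or_intror erefl) sX sY (W _ NX) (W _ NY).
  rewrite scaleN1r memv_cap => /memP -> E; exact/eigen_minusP.
Qed.

(** [para_signature] yields some n at each point; since m = 2n + 1, n is [m./2], the same at all
    points. *)
Lemma signature_of_structure p T : skew g (D T) ->
  ip (g p) (T p) (T p) = -1 -> D T p (T p) = 0 ->
  (forall v, ip (g p) v (T p) = 0 -> D T p (D T p v) = v) ->
  signature (g p) (m./2).+1 m./2.
Proof.
move=> kT TT T0 JJ; pose F := lin1_mx (D T p).
have FE (v : 'rV[R]_m) : v *m F = D T p v by rewrite mul_rV_lin1.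
have kF : F *m g p = - (g p *m F^T).
  apply: ip_mx_inj => u v; have := kT p u v; rewrite /ip -!FE.
  by rewrite mulmxA => ->; rewrite mulmxN mulNmx trmx_mul !mulmxA [RHS]mxE.
have TTm : T p *m g p *m (T p)^T = (-1)%:M by rewrite [LHS]mx11_scalar -TT.
have TF : T p *m F = 0 by rewrite FE.
have FF (v : 'rV[R]_m) : v *m g p *m (T p)^T = 0 -> v *m F *m F = v.
  by move=> E; rewrite !FE JJ // /ip E mxE.
have [n sn] := para_signature (gU p) (gT p) kF TTm TF FF.
suff -> : m./2 = n by [].
by rewrite (proj1 sn) addSn addnn /= uphalf_double.
Qed.

Lemma lift_skew T : smooth_vfield T -> skew (cone_metric g) (lift T) -> skew g (D T).
Proof.
move=> sT kJ p u v; pose z : cone M := (half_line1 R, p).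
have r0 : radius z ^+ 2 != 0 by rewrite expf_neq0 // gt_eqF // radius_gt0.
have := kJ z (cvec 0 u) (cvec 0 v).
rewrite /lift !(conn_lift HM Hg HD HhD _ _ (sT _)) !ip_cone !(mulr0, mul0r, scale0r).
rewrite !(addr0, add0r) -mulrN; exact: mulfI.
Qed.

Lemma cone_para_3_sasakian T1 T2 T3 :
  smooth_vfield T1 -> smooth_vfield T2 -> smooth_vfield T3 ->
  para_hyper_kahler (cone_metric g) hD (lift T1, lift T2, lift T3) ->
  para_3_sasakian g D (T1, T2, T3).
Proof.
move=> s1 s2 s3 [[_ _ _ PHC] [kJ1 kJ2 kJ3] [pJ1 pJ2 pJ3]].
have k1 := lift_skew s1 kJ1; have k2 := lift_skew s2 kJ2; have k3 := lift_skew s3 kJ3.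
have Q p : quaternionic (g p) (D T1 p) (D T2 p) (D T3 p) (T1 p) (T2 p) (T3 p).
  pose z : cone M := (half_line1 R, p).
  have [[_ J11 _] [_ J22 _] J12 J3] := PHC z.
  apply: (cone_quaternionic HM Hg HD HhD s1 s2 s3 (z := z)) => u.
  - by rewrite J11 ?memvf.
  - by rewrite J22 ?memvf.
  - by rewrite J3 ?memvf.
  - by rewrite J3 ?J12 ?opprK ?memvf.
(* The part tangent to M of nabla^ J = 0, evaluated at radius 1 on vectors tangent to M. *)
have cov T : smooth_vfield T -> skew g (D T) -> parallel hD (lift T) ->
    skew (cone_metric g) (lift T) -> forall p u x,
    cov_at D (D T) p u x = ip (g p) x (T p) *: u - ip (g p) x u *: T p.
  move=> sT kT pJ kJ p u x; pose z : cone M := (half_line1 R, p).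
  have /(parallelP HC hU HhD (smooth_endo_lift HM HhD sT) kJ) S0 := pJ.
  have := S0 z (cvec 0 u) (cvec 0 x).
  rewrite (cov_at_cone HM Hg HD HhD _ _ _ sT kT) /cvec !row_mxKr -/(cvec 0 _) -cvec0.
  move=> /cvec_inj[_ E]; rewrite -[RHS]add0r -[X in _ = X + _]E.
  by apply/rowP => i; rewrite !mxE; ring.
have [Qs sg] : (forall p, quaternionic (g p) (D T2 p) (D T1 p) (- D T3 p) (T2 p) (T1 p) (- T3 p))
   /\ forall p, signature (g p) (m./2).+1 m./2.
  split=> p; first exact: quaternionic_swap.
  have [[g11 _ _] [t1 _ _ _] [q1 _] _] := Q p.
  by apply: signature_of_structure k1 g11 t1 _ => v v1; rewrite q1 v1 scale0r addr0.
have sig : exists n, forall p, signature (g p) n.+1 n by exists m./2.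
have PS1 : para_sasakian g D T1.
  apply: (para_sasakian_of s1 k1 sig) => [p|p|p|].
  - by have [[]] := Q p.
  - by have [_ []] := Q p.
  - exact: (para_complex_perp (gT p) (k1 p) (k2 p) (Q p)).
  - exact: cov.
have PS2 : para_sasakian g D T2.
  apply: (para_sasakian_of s2 k2 sig) => [p|p|p|].
  - by have [[]] := Q p.
  - by have [_ []] := Q p.
  - exact: (para_complex_perp (gT p) (k2 p) (k1 p) (Qs p)).
  - exact: cov.
have SS3 : sasakian g D T3.
  split.
  - by split=> //; apply/(killing_skewP HM HD s3).
  - by move=> p; exact: (quat_g33 (gT p) (k1 p) (Q p)).
  - by move=> p v; exact: (quat_f3f3 (gT p) (k1 p) (k2 p) (Q p)).
  - move=> p V sV u; rewrite (cov_endE HM gU HD u (smooth_endo_conn HD s3) k3 sV).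
    rewrite (cov _ s3 k3 pJ3 kJ3) (ipC u) //.
    by apply/rowP => i; rewrite !mxE; ring.
split=> //.
- move=> p; have [[_ _ g12] _ _ _] := Q p; split=> //.
    exact: (quat_g13 (k1 p) (Q p)).
  exact: (quat_g23 (k2 p) (Q p)).
- by move=> p; have [_ []] := Q p.
split=> [p|].
  have [_ [_ _ t12 t21] _ _] := Q p.
  have t13 := quat_t13 (gT p) (Q p); have t23 := quat_t23 (Q p).
  have t31 := quat_t31 (gT p) (Q p); have t32 := quat_t32 (Q p).
  rewrite (torsion_free HD (s1 p) (s2 p)) (torsion_free HD (s1 p) (s3 p)).
  rewrite (torsion_free HD (s2 p) (s3 p)) t12 t21 t13 t23 t31 t32.
  by split; apply/rowP => i; rewrite !mxE; ring.
pose E p := orth (g p) [:: T1 p; T2 p; T3 p].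
have PE p := para_hyper_complex_orth (gT p) (k1 p) (k2 p) (Q p).
have sE T : smooth_vfield T -> (forall p v, v \in E p -> D T p v \in E p) ->
    smooth_end E (D T).
  move=> sT HE p X [sX NX]; split; first exact: (smooth_endo_conn HD sT sX).
  by apply: nbhsS NX => q; exact: HE.
have E1 p v : v \in E p -> D T1 p v \in E p.
  by have [[/subvP H _ _] _ _ _] := PE p => vE; apply: H; exact: memv_img.
have E2 p v : v \in E p -> D T2 p v \in E p.
  by have [_ [/subvP H _ _] _ _] := PE p => vE; apply: H; exact: memv_img.
split; [exact: sE s1 E1|exact: sE s2 E2| |exact: PE].
apply: (sE _ s3) => p v vE; have [_ _ _ ->] := PE p => //.
exact/E1/E2.
Qed.

End Converse.

Unset Implicit Arguments.

(* [nabla] and [hnabla] are the Levi-Civita connections of the manifold and of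
   its cone. *)
Theorem theorem8p2 (R : realType) (m : nat) (M : charted R m)
    (g : M -> 'M[R]_m)
    (nabla : vfield M -> endfield M)
    (hnabla : vfield (cone M) -> endfield (cone M))
    (HM : is_manifold M)
    (Hg : pseudo_riemannian g)
    (Hnabla : levi_civita g nabla)
    (Hhnabla : levi_civita (cone_metric g) hnabla) :
  set_bij [set T : vfield M * vfield M * vfield M | para_3_sasakian g nabla T]
    [set J : endfield (cone M) * endfield (cone M) * endfield (cone M) |
       para_hyper_kahler (cone_metric g) hnabla J]
    (fun T => (hnabla (cone_lift T.1.1), hnabla (cone_lift T.1.2), hnabla (cone_lift T.2))).
Proof.
have HA := manifold_C1_atlas HM.
have smooth3 T1 T2 T3 : para_3_sasakian g nabla (T1, T2, T3) ->
    [/\ smooth_vfield T1, smooth_vfield T2 & smooth_vfield T3].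
  by move=> [_ _ [[_ [s1 _] _ _ _] [_ [s2 _] _ _ _] [[s3 _] _ _ _]] _ _]; split.
(* A field is recovered from J = nabla^ T as J (r d/dr). *)
have inj T T' : smooth_vfield T -> smooth_vfield T' ->
    hnabla (cone_lift T) = hnabla (cone_lift T') -> T = T'.
  move=> sT sT' E; apply/funext => p; pose z : cone M := (half_line1 R, p).
  have := lift_radial HA Hg Hnabla Hhnabla sT z.
  rewrite E (lift_radial HA Hg Hnabla Hhnabla sT' z) !cone_liftE.
  by move=> /cvec_inj[_ /esym].
split.
- move=> [[T1 T2] T3] /= H; exact: (para_3_sasakian_cone HA Hg Hnabla Hhnabla H).
- move=> [[T1 T2] T3] [[T1' T2'] T3']; rewrite !inE /= => H H' [E1 E2 E3].
  have [s1 s2 s3] := smooth3 _ _ _ H; have [s1' s2' s3'] := smooth3 _ _ _ H'.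
  by rewrite (inj _ _ s1 s1' E1) (inj _ _ s2 s2' E2) (inj _ _ s3 s3' E3).
- move=> [[J1 J2] J3] /= H.
  have [[/smooth_endE sJ1 /smooth_endE sJ2 /smooth_endE sJ3 _] [k1 k2 k3] [p1 p2 p3]] := H.
  have L1 := unlift_lift HA Hg Hnabla Hhnabla sJ1 k1 p1.
  have L2 := unlift_lift HA Hg Hnabla Hhnabla sJ2 k2 p2.
  have L3 := unlift_lift HA Hg Hnabla Hhnabla sJ3 k3 p3.
  exists (unlift J1, unlift J2, unlift J3); last by rewrite /= L1 L2 L3.
  apply: (cone_para_3_sasakian HM Hg Hnabla Hhnabla).
  + exact: (smooth_unlift HA Hg Hnabla Hhnabla sJ1 k1 p1).
  + exact: (smooth_unlift HA Hg Hnabla Hhnabla sJ2 k2 p2).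
  + exact: (smooth_unlift HA Hg Hnabla Hhnabla sJ3 k3 p3).
  + by rewrite L1 L2 L3.
Qed.
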